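(* Let $\alpha$ be a composition of $n$ and let $J\subset\{1,\dots,n-1\}$ be the set of integers that are not partial sums $\alpha_1+\dots+\alpha_k$ of $\alpha$. Every partial order $\preceq$ on $\mathfrak S_\alpha$ such that $(\mathfrak S_\alpha,\preceq)$ is a distributive lattice and such that $\preceq$ is between the weak and Bruhat orders on $\mathfrak S_\alpha$ (i.e. $v\le_R w\Rightarrow v\preceq w\Rightarrow v\le w$ for all $v,w\in\mathfrak S_\alpha$) is equal to $\le_{U,n}$ for some binary search tree $U$ with set of labels $\{1,\dots,n-1\}\setminus J$.
   Context: $\mathfrak S_\alpha$ is the set of multipermutations: words of length $n$ with $\alpha_k$ occurrences of the letter $k$ for each $k$. The standardization of $u\in\mathfrak S_\alpha$ is the permutation in $\mathfrak S_n$ obtained by replacing, for each $k$, the occurrences of $k$ from left to right by $\alpha_1+\dots+\alpha_{k-1}+1,\dots,\alpha_1+\dots+\alpha_k$ in increasing order. The weak order $\le_R$ and Bruhat order $\le$ on $\mathfrak S_\alpha$ are the restrictions, via standardization, of the right weak order and of the Bruhat order of $\mathfrak S_n$; in $\mathfrak S_n$, $v\le_R w$ iff every pair of values $i<j$ with $j$ before $i$ in the word $v$ also has $j$ before $i$ in $w$. The poset $\mathcal P_n$ is the set of pairs of integers $(i,j)$ with $1\le i<j\le n$, ordered by $(i_1,j_1)\le(i_2,j_2)$ iff $i_2\le i_1$ and $j_1\le j_2$. $\mathcal P_\alpha$ is its subposet of pairs $(i,j)$ for which there is $m\notin J$ with $i\le m\le j-1$. For $\sigma=\sigma_1\cdots\sigma_{n-1}\in\mathfrak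 S_{n-1}$ and $1\le k\le n-1$ let $\mathcal R_{\sigma,k}=\{x\in\mathcal P_n: (k,k+1)\le x\text{ and }(\sigma_\ell,\sigma_\ell+1)\not\le x\text{ for all }\ell<\sigma^{-1}(k)\}$. These sets partition $\mathcal P_n$; each gets the induced order and $\mathcal R_\sigma$ is the disjoint union of these posets. The binary search tree of a word with distinct letters has as root its first letter, and its left (resp. right) subtree is the binary search tree of the subword of letters smaller (resp. greater) than the root. $\mathcal R_\sigma,\mathcal R_{\sigma,k}$ depend only on the binary search tree $T$ of $\sigma$ and are written $\mathcal R_T,\mathcal R_{T,k}$. Let $(i_{T,k},j_{T,k})=\max\mathcal R_{T,k}$. For $w\in\mathfrak S_n$ (as a word) let $w^{L,k}$ (resp. $w^{R,k}$) be the subword of values in $[i_{T,k},k]$ (resp. $[k+1,j_{T,k}]$). $I_T(w)\subset\mathcal R_T$ is the set such that for $i_{T,k}\le i\le k$, $k+1\le j\le j_{T,k}$: $(i,j)\in I_T(w)$ iff the value $w^{L,k}_{i-i_{T,k}+1}$ appears after the value $w^{R,k}_{j-k}$ in $w$. For a binary search tree $U$ with label set $\{1,\dots,n-1\}\setminus J$, let $T$ be any completion of $U$ to a binary search tree with label set $\{1,\dots,n-1\}$ (obtained by inserting the labels in $J$ below the nodes of $U$). For $u\in\mathfrak S_\alpha$ with standardization $w$, $I_{U,n}(u)=I_T(w)\cap\mathcal P_\alpha$ (independent of the choice of $T$), and $v\le_{U,n}u$ iff $I_{U,n}(v)\subset I_{U,n}(u)$. *)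

(* Defs.v *)
From HB Require Import structures.
From mathcomp Require Import all_boot all_order all_fingroup zify.

Set Implicit Arguments.
Unset Strict Implicit.
Unset Printing Implicit Defensive.

(** Conventions: letters, values, labels and the coordinates of the elements of
    [Pn n] are natural numbers counted from 1, as in the mathematics; only the
    elements of ['S_n], which act on ['I_n], and the positions in a sequence
    are counted from 0. *)

Definition is_composition (alpha : seq nat) : bool := 0 \notin alpha.

Definition partial_sums (alpha : seq nat) : seq nat :=
  [seq sumn (take k alpha) | k <- iota 1 (size alpha)].

(** The set J, for a composition of [n = sumn alpha]. *)
Definition Jset (alpha : seq nat) : seq nat :=
  [seq m <- iota 1 (sumn alpha).-1 | m \notin partial_sums alpha].

Definition Jcompl (alpha : seq nat) : seq nat :=
  [seq m <- iota 1 (sumn alpha).-1 | m \notin Jset alpha].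

Definition is_multiperm (alpha u : seq nat) : bool :=
  (size u == sumn alpha)
  && all (fun k => count_mem k u == nth 0 alpha k.-1) (iota 1 (size alpha)).

Record multiperm (alpha : seq nat) : Type := Multiperm {
  mword :> seq nat;
  mwordP : is_multiperm alpha mword }.

HB.instance Definition _ alpha := [isSub for @mword alpha].
HB.instance Definition _ alpha := [Countable of multiperm alpha by <:].

Section Standardization.
Variables (alpha : seq nat) (u : multiperm alpha).
Let n := sumn alpha.

(** The value, counted from 0, given to the letter [k] in position [p]. *)
Definition std_val (p : nat) : nat :=
  let k := nth 0 u p in sumn (take k.-1 alpha) + count_mem k (take p u).

Lemma multiperm_size : size u = n.
Proof. by case/andP: (mwordP u) => /eqP. Qed.

Lemma multiperm_count k :
  0 < k <= size alpha -> count_mem k u = nth 0 alpha k.-1.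
Proof.
move=> hk; case/andP: (mwordP u) => _ /allP /(_ k).
by rewrite mem_iota => /(_ _)/eqP-> //; lia.
Qed.

Lemma multiperm_letter k : k \in (u : seq nat) -> 0 < k <= size alpha.
Proof.
move: k; apply/allP; rewrite all_count; apply/eqP.
have Hc : forall (s : seq nat) r,
    count (fun k => 0 < k <= r) s = \sum_(1 <= k < r.+1) count_mem k s.
  move=> s r; elim: s => [|x s IH] /=; first by rewrite big1.
  rewrite big_split /= -IH; congr (_ + _).
  case: (boolP (0 < x <= r)) => hx.
    rewrite (bigD1_seq x) /= ?mem_index_iota ?iota_uniq //.
    by rewrite eqxx big1 // => i /negbTE; rewrite eq_sym => ->.
  rewrite big_seq big1 // => i; rewrite mem_index_iota => hi.
  by case: eqP => // E; move/negP: hx; case; rewrite E.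
rewrite Hc multiperm_size /n sumnE big_add1 [RHS](big_nth 0) /=.
rewrite !big_mkord; apply: eq_bigr => i _.
by rewrite multiperm_count // ltn_ord.
Qed.

Lemma std_val_lt p : p < n ->
  std_val p < sumn (take (nth 0 u p) alpha).
Proof.
move=> hp; rewrite /std_val; set k := nth 0 u p.
have ku : k \in (u : seq nat) by rewrite mem_nth // multiperm_size.
have hk := multiperm_letter ku.
have -> : take k alpha = rcons (take k.-1 alpha) (nth 0 alpha k.-1).
  by rewrite -take_nth ?prednK //; lia.
rewrite sumn_rcons ltn_add2l -multiperm_count //.
rewrite -[X in _ < count _ X](cat_take_drop p) count_cat.
rewrite (drop_nth 0) ?multiperm_size //= -/k eqxx; lia.
Qed.

Lemma sumn_take_le (s : seq nat) i j :
  i <= j -> sumn (take i s) <= sumn (take j s).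
Proof.
move=> hij; rewrite -[take j s](cat_take_drop i) take_takel // sumn_cat.
exact: leq_addr.
Qed.

Lemma std_val_ltn (p : 'I_n) : std_val p < n.
Proof.
apply: leq_trans (std_val_lt (ltn_ord p)) _.
set k := nth 0 u p.
by rewrite /n -[X in _ <= sumn X](cat_take_drop k) sumn_cat leq_addr.
Qed.

Definition std_fun (p : 'I_n) : 'I_n := Ordinal (std_val_ltn p).

Lemma std_fun_inj : injective std_fun.
Proof.
suff H : forall p q : 'I_n, p < q -> std_val p <> std_val q.
  move=> p q /(congr1 val) /= E; apply/val_inj => /=.
  by case: (ltngtP p q) => // [/H|/H/nesym].
move=> p q hpq.
have hp := std_val_lt (ltn_ord p); have hq := std_val_lt (ltn_ord q).
case: (ltngtP (nth 0 u p) (nth 0 u q)) => hk.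
- have : sumn (take (nth 0 u p) alpha) <= sumn (take (nth 0 u q).-1 alpha).
    by apply: sumn_take_le; lia.
  by rewrite {2}/std_val; lia.
- have : sumn (take (nth 0 u q) alpha) <= sumn (take (nth 0 u p).-1 alpha).
    by apply: sumn_take_le; lia.
  by rewrite {1}/std_val; lia.
rewrite /std_val hk => /addnI.
rewrite -[take q u](cat_take_drop p) take_takel ?count_cat; last exact: ltnW.
have -> : drop p (take q u) = nth 0 u p :: drop p.+1 (take q u).
  rewrite (drop_nth 0) ?nth_take // size_takel ?multiperm_size //.
  exact/ltnW/ltn_ord.
by rewrite /= hk eqxx; lia.
Qed.

Definition std : 'S_n := perm std_fun_inj.

End Standardization.

Definition oneline n (w : 'S_n) : seq nat := [seq (w p).+1 | p <- enum 'I_n].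

(** [(w^-1)%g i] is the position of the value [i] in the word [w]. *)
Definition weak_le n (v w : 'S_n) : bool :=
  [forall i : 'I_n, forall j : 'I_n,
     (i < j) && ((v^-1)%g j < (v^-1)%g i) ==> ((w^-1)%g j < (w^-1)%g i)].

Definition perm_length n (w : 'S_n) : nat :=
  #|[set x : 'I_n * 'I_n | (x.1 < x.2) && (w x.2 < w x.1)]|.

(** Bruhat order: reflexive-transitive closure of [v -> v t], where [t] is a
    transposition that increases the length. *)
Definition bruhat_le n : rel 'S_n :=
  connect (fun v w : 'S_n =>
    [exists i : 'I_n, exists j : 'I_n, w == (v * tperm i j)%g]
    && (perm_length v < perm_length w)).

Definition partial_order (T : Type) (r : rel T) : Prop :=
  [/\ reflexive r, antisymmetric r & transitive r].

(** [(T, r)] is a distributive lattice, i.e. is a copy of one of the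
    [distrLatticeType]s of the library. *)
Definition distributive_lattice (T : Type) (r : rel T) : Prop :=
  exists (d : Order.disp_t) (L : distrLatticeType d) (f : T -> L),
    bijective f /\ forall x y, r x y = (f x <= f y)%O.

(** The order of P_n is [pair_le]. Finite subsets of P_n are represented by
    sequences, of which only the membership matters. *)
Definition pair_le (x y : nat * nat) : bool := (y.1 <= x.1) && (x.2 <= y.2).

Definition Pn (n : nat) : seq (nat * nat) :=
  [seq x <- [seq (i, j) | i <- iota 1 n, j <- iota 1 n] | x.1 < x.2].

Definition Palpha (alpha : seq nat) : seq (nat * nat) :=
  [seq x <- Pn (sumn alpha) | has (fun m => x.1 <= m <= x.2.-1) (Jcompl alpha)].

Definition Rword (n : nat) (sigma : seq nat) (k : nat) : seq (nat * nat) :=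
  [seq x <- Pn n | pair_le (k, k.+1) x
     && all (fun l => ~~ pair_le (l, l.+1) x) (take (index k sigma) sigma)].

Inductive tree : Type := Leaf | Node of tree & nat & tree.

(** [bst s] is the binary search tree of the word [s]; the first argument of
    [bst_rec] only bounds the depth of the recursion. *)
Fixpoint bst_rec (m : nat) (s : seq nat) : tree :=
  if m is m'.+1 then
    if s is k :: s' then
      Node (bst_rec m' [seq x <- s' | x < k]) k (bst_rec m' [seq x <- s' | k < x])
    else Leaf
  else Leaf.

Definition bst (s : seq nat) : tree := bst_rec (size s) s.

(** [U] is a binary search tree whose set of labels is that of the
    duplicate-free sequence [L]. *)
Definition is_bst_on (L : seq nat) (U : tree) : Prop :=
  exists2 s, perm_eq s L & U = bst s.

Fixpoint insert (T : tree) (x : nat) : tree :=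
  if T is Node l k r then
    if x < k then Node (insert l x) k r else Node l k (insert r x)
  else Node Leaf x Leaf.

(** By [bst_preorder_bst] below, if [T] is the binary search tree of a word with
    distinct letters, then it is that of [preorder T]. *)
Fixpoint preorder (T : tree) : seq nat :=
  if T is Node l k r then k :: preorder l ++ preorder r else [::].

(** R_{T,k} is R_{sigma,k} for any sigma with binary search tree T (see
    [RtreeE] below). *)
Definition Rtree (n : nat) (T : tree) (k : nat) : seq (nat * nat) :=
  Rword n (preorder T) k.

(** The maximum (i_{T,k}, j_{T,k}) of R_{T,k}; the default value is never used
    when [k] is a label of [T] and [0 < k < n] (see [Rtree_maxP] below). *)
Definition Rtree_max (n : nat) (T : tree) (k : nat) : nat * nat :=
  head (k, k.+1)
    [seq x <- Rtree n T k | all (fun y => pair_le y x) (Rtree n T k)].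

Definition subword (w : seq nat) (a b : nat) : seq nat :=
  [seq x <- w | a <= x <= b].

(** I_T(w), for a permutation given by its one-line notation [w]. *)
Definition Itree (n : nat) (T : tree) (w : seq nat) : seq (nat * nat) :=
  [seq x <- Pn n | has (fun k =>
     let: (a, b) := Rtree_max n T k in
     let: (i, j) := x in
     [&& a <= i <= k, k.+1 <= j <= b
       & index (nth 0 (subword w k.+1 b) (j - k.+1)) w
           < index (nth 0 (subword w a k) (i - a)) w]) (preorder T)].

(** A completion of [U] to the label set {1, ..., n-1}; by [IUE] below the order
    of insertion of the elements of J is irrelevant. *)
Definition completion (alpha : seq nat) (U : tree) : tree :=
  foldl insert U (Jset alpha).

Definition IU (alpha : seq nat) (U : tree) (u : multiperm alpha) :
    seq (nat * nat) :=
  [seq x <- Itree (sumn alpha) (completion alpha U) (oneline (std u))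
     | x \in Palpha alpha].

Definition leU (alpha : seq nat) (U : tree) (v u : multiperm alpha) : Prop :=
  {subset IU U v <= IU U u}.

Lemma bst_rec_enough m s : size s <= m -> bst_rec m s = bst s.
Proof.
rewrite /bst; elim/ltn_ind: m s => m IH [|k s]; first by case: m {IH}.
case: m IH => // m IH /=; rewrite ltnS => hs.
have hf a : size (filter a s) <= size s by rewrite size_filter count_size.
have h1 a : bst_rec m (filter a s) = bst_rec (size (filter a s)) (filter a s).
  by apply: IH => //; apply: leq_trans (hf a) hs.
have h2 a : bst_rec (size s) (filter a s)
    = bst_rec (size (filter a s)) (filter a s).
  by apply: IH.
by rewrite !h1 !h2.
Qed.

Lemma bst_cons k s :
  bst (k :: s) = Node (bst [seq x <- s | x < k]) k (bst [seq x <- s | k < x]).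
Proof. by rewrite {1}/bst /= !bst_rec_enough // size_filter count_size. Qed.

Lemma bst_ind (P : seq nat -> Prop) :
  P [::] ->
  (forall k s, P [seq x <- s | x < k] -> P [seq x <- s | k < x] -> P (k :: s)) ->
  forall s, P s.
Proof.
move=> P0 PS s; have [m hm] := ubnP (size s); elim: m s hm => // m IH [|k s] //.
by rewrite ltnS => hs; apply: PS; apply: IH;
  rewrite size_filter; apply: leq_ltn_trans (count_size _ _) hs.
Qed.

Lemma perm_preorder_bst s : uniq s -> perm_eq (preorder (bst s)) s.
Proof.
elim/bst_ind: s => [|k s IH1 IH2] //; rewrite cons_uniq => /andP[ks us].
rewrite bst_cons /= perm_cons.
apply: perm_trans (perm_cat (IH1 _) (IH2 _)) _; rewrite ?filter_uniq //.
rewrite perm_sym -(perm_filterC (fun x => x < k) s) perm_cat2l.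
apply: (eq_ind_r (fun t => perm_eq t _) (perm_refl _)); apply: eq_in_filter => x xs /=.
by case: (ltngtP x k) => // E; rewrite -E xs in ks.
Qed.

Lemma bst_preorder_bst s : uniq s -> bst (preorder (bst s)) = bst s.
Proof.
elim/bst_ind: s => [|k s IH1 IH2] //; rewrite cons_uniq => /andP[ks us].
have m1 : all (fun x => x < k) (preorder (bst [seq x <- s | x < k])).
  rewrite (perm_all _ (perm_preorder_bst _)) ?filter_all ?filter_uniq //.
have m2 : all (fun x => k < x) (preorder (bst [seq x <- s | k < x])).
  rewrite (perm_all _ (perm_preorder_bst _)) ?filter_all ?filter_uniq //.
rewrite !(bst_cons k s) /= bst_cons !filter_cat.
have E1 : [seq x <- preorder (bst [seq x <- s | k < x]) | x < k] = [::].
  apply/eqP; rewrite -[_ == _]negbK -has_filter.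
  by apply/hasPn => x /(allP m2); lia.
have E2 : [seq x <- preorder (bst [seq x <- s | x < k]) | k < x] = [::].
  apply/eqP; rewrite -[_ == _]negbK -has_filter.
  by apply/hasPn => x /(allP m1); lia.
by rewrite E1 E2 cats0 /= (all_filterP m1) (all_filterP m2) IH1 ?IH2
  ?filter_uniq.
Qed.

Lemma bst_rcons s x : x \notin s -> bst (rcons s x) = insert (bst s) x.
Proof.
elim/bst_ind: s => [|k s IH1 IH2] //; rewrite inE negb_or => /andP[xk xs].
rewrite rcons_cons !bst_cons !filter_rcons /=.
case: (ltngtP x k) xk => // hx _; first by rewrite IH1 // mem_filter negb_and xs orbT.
by rewrite IH2 // mem_filter negb_and xs orbT.
Qed.

Lemma bst_cat s t : uniq (s ++ t) -> bst (s ++ t) = foldl insert (bst s) t.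
Proof.
elim: t s => [|x t IH] s; rewrite ?cats0 //= -cat_rcons => us.
by rewrite IH // bst_rcons //; move: us; rewrite cat_uniq rcons_uniq;
  case/andP => /andP[].
Qed.

Fixpoint ancestors (T : tree) (k : nat) : seq nat :=
  if T is Node l r t then
    if k == r then [::] else r :: ancestors (if k < r then l else t) k
  else [::].

Lemma filter_take_index (a : pred nat) k s : a k ->
  [seq x <- take (index k s) s | a x]
    = take (index k (filter a s)) (filter a s).
Proof.
move=> ak; elim: s => //= x s IH; case: eqP => [->|/eqP xk] /=.
  by rewrite ak /= eqxx.
by case: ifP => //= _; rewrite (negbTE xk) IH.
Qed.

Lemma all_before_ancestors i j k s : i <= k < j -> k \in s ->
  all (fun l => ~~ (i <= l < j)) (take (index k s) s)
    = all (fun l => ~~ (i <= l < j)) (ancestors (bst s) k).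
Proof.
move=> hk; elim/bst_ind: s => [|r s IH1 IH2] //; rewrite inE bst_cons /=.
rewrite eq_sym; case: eqP => [//|/eqP rk] /= ks.
case: (boolP (i <= r < j)) => //= hr.
have H (a : pred nat) : a k -> (forall l, i <= l < j -> a l) ->
  all (fun l => ~~ (i <= l < j)) (take (index k s) s)
    = all (fun l => ~~ (i <= l < j)) (take (index k (filter a s)) (filter a s)).
  move=> ak ha; rewrite -filter_take_index // all_filter; apply: eq_all => l /=.
  by case: (boolP (i <= l < j)) => [/ha-> |]; rewrite ?implybT.
case: (ltngtP k r) rk => // kr _.
  rewrite (H (fun l => l < r)) //; last by lia.
  by rewrite IH1 // mem_filter kr.
rewrite (H (fun l => r < l)) //; last by lia.
by rewrite IH2 // mem_filter kr.
Qed.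

Lemma RwordE n s k : k \in s ->
  Rword n s k = [seq x <- Pn n | (x.1 <= k < x.2)
                  && all (fun l => ~~ (x.1 <= l < x.2)) (ancestors (bst s) k)].
Proof.
move=> ks; apply: eq_filter => -[i j]; rewrite /pair_le /=.
by case: (boolP (i <= k < j)) => //= hk; apply: all_before_ancestors.
Qed.

Lemma RtreeE n s k : uniq s -> k \in s -> Rtree n (bst s) k = Rword n s k.
Proof.
move=> us ks; rewrite /Rtree !RwordE ?bst_preorder_bst //.
by rewrite (perm_mem (perm_preorder_bst us)).
Qed.

Lemma mem_Pn n x : (x \in Pn n) = (0 < x.1 < x.2) && (x.2 <= n).
Proof.
case: x => i j; rewrite mem_filter /=; apply/idP/idP.
  case/andP => hij /allpairsP[[i' j']] /= []; rewrite !mem_iota.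
  by move=> hi hj [? ?]; subst; lia.
move=> h; rewrite (_ : i < j) /=; last by lia.
by apply/allpairsP; exists (i, j); split => //=; rewrite mem_iota; lia.
Qed.

Lemma Rtree_maxP n s k : uniq s -> k \in s -> 0 < k < n ->
  Rtree_max n (bst s) k \in Rword n s k
  /\ {in Rword n s k, forall x, pair_le x (Rtree_max n (bst s) k)}.
Proof.
move=> us ks hk; rewrite /Rtree_max RtreeE //; set R := Rword n s k.
have inR i j : ((i, j) \in R) = [&& 0 < i <= k, k < j <= n
    & all (fun l => ~~ (i <= l < j)) (take (index k s) s)].
  rewrite mem_filter mem_Pn /pair_le /=.
  by case: (all _ _); rewrite ?andbF //=; lia.
have kR : (k, k.+1) \in R.
  rewrite inR leqnn ltnS leqnn; apply/and3P; split; try lia.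
  apply/allP => l hl; apply/negP => /andP[h1 h2].
  have E : l = k by lia.
  by move: hl; rewrite E in_take_leq ?ltnn // index_size.
have joinR x y : x \in R -> y \in R -> (minn x.1 y.1, maxn x.2 y.2) \in R.
  case: x y => [i j] [i' j']; rewrite !inR /=.
  move=> /and3P[h1 h2 /allP h3] /and3P[h4 h5 /allP h6]; apply/and3P; split; try lia.
  by apply/allP => l hl; have := h3 l hl; have := h6 l hl; lia.
have [z zR hz] : exists2 z, z \in R & all (fun y => pair_le y z) R.
  have : {subset R <= R} by [].
  elim: {1 4}R => [|x t IH] hs; first by exists (k, k.+1).
  have [y yt|z zR /allP hz] := IH; first by apply: hs; rewrite inE yt orbT.
  exists (minn x.1 z.1, maxn x.2 z.2); first by apply: joinR => //; apply: hs; rewrite mem_head.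
  rewrite /= /pair_le /=; apply/andP; split; first by lia.
  by apply/allP => y /hz; rewrite /pair_le; lia.
have : z \in [seq x <- R | all (fun y => pair_le y x) R] by rewrite mem_filter hz.
case E: [seq x <- R | _] => [|y t] //= _.
have : y \in [seq x <- R | all (fun y => pair_le y x) R] by rewrite E mem_head.
by rewrite mem_filter => /andP[/allP].
Qed.

Lemma eq_Rtree_max n T T' k :
  Rtree n T k = Rtree n T' k -> Rtree_max n T k = Rtree_max n T' k.
Proof. by rewrite /Rtree_max => ->. Qed.

Lemma mem_Jset alpha m :
  (m \in Jset alpha) = (0 < m < sumn alpha) && (m \notin Jcompl alpha).
Proof. rewrite !mem_filter !mem_iota; case: (m \in partial_sums alpha) => /=; lia. Qed.

Lemma Itree_Palpha alpha s js w :
  perm_eq s (Jcompl alpha) -> perm_eq js (Jset alpha) ->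
  [seq x <- Itree (sumn alpha) (foldl insert (bst s) js) w | x \in Palpha alpha]
  = [seq x <- Itree (sumn alpha) (bst s) w | x \in Palpha alpha].
Proof.
move=> ps pj; set n := sumn alpha.
have us : uniq s by rewrite (perm_uniq ps) filter_uniq ?iota_uniq.
have uj : uniq js by rewrite (perm_uniq pj) filter_uniq ?iota_uniq.
have dj m : (m \in js) = (0 < m < n) && (m \notin s).
  by rewrite (perm_mem pj) (perm_mem ps) mem_Jset.
have usj : uniq (s ++ js).
  by rewrite cat_uniq us uj andbT; apply/hasPn => m; rewrite dj => /andP[].
rewrite -bst_cat // -!filter_predI; apply: eq_in_filter => -[i j] _ /=.
case: (boolP (_ \in Palpha alpha)) => //=; rewrite mem_filter /= => /andP[hP _].
rewrite (perm_has _ (perm_preorder_bst us)) (perm_has _ (perm_preorder_bst usj)).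
rewrite has_cat [X in _ || X](_ : _ = false) ?orbF.
  congr (_ && _); apply: eq_in_has => k ks; rewrite (eq_Rtree_max (T' := bst s)) //.
  rewrite !RtreeE //; last by rewrite mem_cat ks.
  by apply: eq_filter => x; rewrite index_cat ks take_cat index_mem ks.
apply/hasPn => k kj; have hk : k \in s ++ js by rewrite mem_cat kj orbT.
have := kj; rewrite dj => /andP[kn kNs].
have [] := Rtree_maxP usj hk kn; case: (Rtree_max _ _ _) => a b.
rewrite mem_filter => /andP[/andP[_ /allP hR] _] _.
apply/negP => /and3P[h1 h2 _]; case/hasP: hP => m; rewrite -(perm_mem ps) => ms hm.
have : m \in take (index k (s ++ js)) (s ++ js).
  by rewrite index_cat (negbTE kNs) take_cat ltnNge leq_addr mem_cat ms.
by move/hR; rewrite /pair_le /=; lia.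
Qed.

Lemma IUE alpha U (u : multiperm alpha) js :
  is_bst_on (Jcompl alpha) U -> perm_eq js (Jset alpha) ->
  IU U u = [seq x <- Itree (sumn alpha) (foldl insert U js) (oneline (std u))
              | x \in Palpha alpha].
Proof. by case=> s ps -> pj; rewrite Itree_Palpha // /IU Itree_Palpha. Qed.

(* Main.v *)
(** Covers of the weak order raise the length by one and the length strictly
    increases in the Bruhat order, so the lattice is graded by the number of
    inversions; being distributive, it satisfies
    [len (join x y) + len (meet x y) = len x + len y].

    Values and cuts are counted so that a cut [k] separates [i < k <= j]. In an
    interval [a, b) of values, let [rect a k b] be the element that inverts
    exactly the pairs [a <= i < k <= j < b]. An element supported in [a, b) lies
    above it as soon as it inverts these pairs, and conversely by the Bruhat
    order. Hence the joins of these elements are known, and so are the lengths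
    of their meets: the meet of all of them is nontrivial. An atom [atom k] below
    it gives the root [k] of the tree: by [atom_rect_asym], [atom k] is then the
    only atom below [rect a k b].

    For the root [k], the element [rect a k b] and the greatest elements
    supported in [a, k) and in [k, b) have pairwise trivial meets, and by length
    their join is the greatest element supported in [a, b). By distributivity
    every [x] is the join of its meets with these three elements. The last two
    meets are the restrictions of [x] to [a, k) and to [k, b). The first one is
    the shuffle of two sorted words that has the same shape as [x]: it is below
    [x] in the Bruhat order, which bounds its shape, and its length is the number
    of inversions of [x] across [k]. The comparison of [x] and [y] thus amounts
    to that of the shapes at [k] and of the restrictions, which are treated
    recursively. *)

From HB Require Import structures.
Require Import Defs.
From mathcomp Require Import all_boot all_order all_fingroup zify.

Set Implicit Arguments.
Unset Strict Implicit.
Unset Printing Implicit Defensive.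

(** * Bruhat order *)

Section Permutations.
Variable n : nat.
Implicit Types v w p : 'S_n.

Lemma perm_lengthV w : perm_length w^-1 = perm_length w.
Proof.
suff H v : perm_length v <= perm_length v^-1.
  by apply/eqP; rewrite eqn_leq H -{2}(invgK w) H.
pose f (x : 'I_n * 'I_n) := (v x.2, v x.1).
have fI : injective f by case=> [a b] [c d] [/perm_inj-> /perm_inj->].
rewrite /perm_length -(card_imset _ fI); apply/subset_leq_card/subsetP => y.
by case/imsetP=> x; rewrite !inE => /andP[h1 h2] -> /=; rewrite !permK h1 h2.
Qed.

(** To be read with [p] the inverse of a permutation [w]: then [tperm i j * p] is
    the inverse of [w] with the values [i] and [j] exchanged. *)
Lemma perm_length_tperm p (i j : 'I_n) : i < j -> p i < p j ->
  perm_length p <= perm_length (tperm i j * p).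
Proof.
move=> ij pij; set t := tperm i j.
(* Relabelling by [t] turns an inversion of [p] into one of [t * p]; when it would put the pair in
   the wrong order, the pair itself is still an inversion. *)
pose f (x : 'I_n * 'I_n) := if t x.1 < t x.2 then (t x.1, t x.2) else x.
set A := [set x : 'I_n * 'I_n | (x.1 < x.2) && (p x.2 < p x.1)].
have fI : {in A &, injective f}.
  move=> [a b] [c d]; rewrite !inE /f /= => /andP[ab _] /andP[cd _].
  case: ifP => h1; case: ifP => h2 //.
  - by case=> /perm_inj-> /perm_inj->.
  - by case=> E1 E2; move: h2; rewrite -E1 -E2 !tpermK ab.
  - by case=> E1 E2; move: h1; rewrite E1 E2 !tpermK cd.
rewrite /perm_length -/A -(card_in_imset fI).
apply/subset_leq_card/subsetP => y /imsetP[[a b]]; rewrite !inE /f /=.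
case/andP=> ab pba ->; case: ifP => [h|] /=; first by rewrite !permM !tpermK h.
rewrite !permM ab /= /t; case: tpermP => [Ea|Ea|na1 na2];
  case: tpermP => [Eb|Eb|nb1 nb2]; subst; rewrite ?ltnn //=; try lia.
Qed.

(** For [p] the inverse of a permutation, this is the rank function of the tableau criterion for the
    Bruhat order: it counts the large values in a prefix of the word. *)
Definition rank_above p (k q : nat) := #|[set i : 'I_n | (k <= i) && (p i < q)]|.

(** The exchange moves the larger value [j] to the earlier position [p i], so no prefix loses large
    values. *)
Lemma rank_above_tperm p (i j : 'I_n) k q : i < j -> p i < p j ->
  rank_above p k q <= rank_above (tperm i j * p) k q.
Proof.
move=> ij pij; rewrite /rank_above.
case: (boolP ((k <= j) && (p i < q))) => [/andP[kj piq]|h].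
  case: (leqP k i) => ki.
    rewrite -(card_imset _ (@perm_inj _ (tperm i j))); apply/subset_leq_card/subsetP => y.
    case/imsetP=> x; rewrite inE => /andP[kx px] ->; rewrite inE permM tpermK px andbT.
    by case: tpermP => [_|_|] //; lia.
  case: (ltnP (p j) q) => pjq.
    apply/subset_leq_card/subsetP => x; rewrite !inE => /andP[kx px].
    rewrite kx permM; case: tpermP => [Ex|Ex|_ _ //]; subst => //; lia.
  apply/subset_leq_card/subsetP => x; rewrite !inE => /andP[kx px].
  rewrite kx permM; case: tpermP => [Ex|Ex|_ _ //]; subst => //; lia.
apply/subset_leq_card/subsetP => x; rewrite !inE => /andP[kx px].
rewrite kx permM; case: tpermP => [Ex|Ex|//]; subst; move: h; rewrite negb_and.
  by lia.
by lia.
Qed.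

(** If the larger value moved to the later position, [perm_length_tperm], applied to the result,
    would show that the length does not increase. *)
Lemma tperm_lt (w : 'S_n) (a b : 'I_n) : a != b ->
  perm_length w < perm_length (w * tperm a b) ->
  exists i j : 'I_n, [/\ i < j, w^-1%g i < w^-1%g j
    & (w * tperm a b)^-1%g = (tperm i j * w^-1)%g].
Proof.
wlog: a b / a < b => [H|ab _ hl].
  move=> nab; have [ab|ba|/val_inj E] := ltngtP a b; first exact: H.
    by rewrite tpermC; apply: H; rewrite // eq_sym.
  by rewrite E eqxx in nab.
exists a, b; split=> //; last by rewrite invMg tpermV.
rewrite ltnNge; apply/negP => h.
have ne : (w^-1%g a : nat) != w^-1%g b.
  by rewrite val_eqE (inj_eq perm_inj) -val_eqE neq_ltn ab.
have E : perm_length (w * tperm a b)%g = perm_length (tperm a b * w^-1)%g.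
  by rewrite -perm_lengthV invMg tpermV.
have := @perm_length_tperm (tperm a b * w^-1) a b ab.
rewrite mulgA tperm2 mul1g !permM tpermL tpermR perm_lengthV -E.
have h2 : w^-1%g b < w^-1%g a by lia.
by move/(_ h2); rewrite leqNgt hl.
Qed.

Lemma bruhat_ind (P : 'S_n -> 'S_n -> Prop) :
  (forall v, P v v) ->
  (forall v w u (i j : 'I_n), i < j -> v^-1%g i < v^-1%g j ->
     w^-1%g = (tperm i j * v^-1)%g -> perm_length v < perm_length w ->
     P w u -> P v u) ->
  forall v w, bruhat_le v w -> P v w.
Proof.
move=> P0 PS v w /connectP[s]; elim: s v => [|u s IH] v /=; first by move=> _ ->.
case/andP=> /andP[/existsP[a /existsP[b /eqP E]] hl] hp hw.
have ab : a != b by apply/eqP => E2; move: hl; rewrite E E2 tperm1 mulg1 ltnn.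
rewrite E in hl; have [i [j [ij pij E2]]] := tperm_lt ab hl.
by apply: (PS v u w i j ij pij); rewrite ?E //; rewrite -E; apply: IH.
Qed.

(** One direction of the tableau criterion. With [bruhat_length], it is all that is used of the
    Bruhat order below. *)
Lemma bruhat_rank v w k q : bruhat_le v w ->
  rank_above v^-1 k q <= rank_above w^-1 k q.
Proof.
elim/bruhat_ind: v w / => // v w u i j ij pij E _.
by apply: leq_trans; rewrite E rank_above_tperm.
Qed.

Lemma bruhat_length v w : bruhat_le v w -> v = w \/ perm_length v < perm_length w.
Proof.
elim/bruhat_ind: v w / => [|v w u i j _ _ _ h [<-|]]; [by left|by right|right].
exact: ltn_trans h _.
Qed.

End Permutations.

(** * Standardization *)

Section Multipermutations.
Variable alpha : seq nat.
Local Notation n := (sumn alpha).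
Local Notation T := (multiperm alpha).
Implicit Types x y : T.

Lemma cutE k : (k \in Jcompl alpha) = (0 < k < n) && (k \in partial_sums alpha).
Proof. rewrite !mem_filter !mem_iota; case: (_ \in partial_sums _) => /=; lia. Qed.

(** The letter whose block of standardized values, counted from 0, contains [i]. *)
Definition letter (i : nat) : nat :=
  (find (fun c => i < sumn (take c.+1 alpha)) (iota 0 (size alpha))).+1.

Arguments letter : simpl never.

Lemma letterP i : i < n ->
  [/\ letter i <= size alpha, sumn (take (letter i).-1 alpha) <= i
    & i < sumn (take (letter i) alpha)].
Proof.
move=> hi; rewrite /letter /=; set P := fun c => _.
have hP : has P (iota 0 (size alpha)).
  have hs : 0 < size alpha by case: alpha hi.
  apply/hasP; exists (size alpha).-1; first by rewrite mem_iota; lia.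
  by rewrite /P prednK // take_size.
have := hP; rewrite has_find size_iota => hf; split=> //.
  case E: (find P _) => [|c]; first by rewrite take0.
  have := @before_find _ 0 P (iota 0 (size alpha)) c; rewrite E ltnSn => /(_ isT).
  by rewrite nth_iota ?add0n /P /= => [h|]; lia.
by have := nth_find 0 hP; rewrite nth_iota.
Qed.

Lemma letter_eq i c : i < n -> 0 < c <= size alpha ->
  (letter i == c) = (sumn (take c.-1 alpha) <= i < sumn (take c alpha)).
Proof.
move=> /letterP[l1 l2 l3] hc; apply/eqP/idP => [<-|h]; first by rewrite l2 l3.
case: (ltngtP (letter i) c) => // hl.
  have := @sumn_take_le alpha (letter i) c.-1 ltac:(lia); lia.
have := @sumn_take_le alpha c (letter i).-1 ltac:(lia); lia.
Qed.

Lemma letter_std x p : p < n -> letter (std_val x p) = nth 0 x p.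
Proof.
move=> pn; have l : 0 < nth 0 x p <= size alpha.
  by apply: (@multiperm_letter _ x); rewrite mem_nth ?multiperm_size.
suff hv : std_val x p < n.
  by apply/eqP; rewrite letter_eq // std_val_lt // /std_val leq_addr.
exact: (std_val_ltn x (Ordinal pn)).
Qed.

(** A left inverse of [std]: it yields injectivity and the finite type structure on which all the
    counting relies. *)
Definition std_inv (w : 'S_n) : option T := insub [seq letter (w p) | p <- enum 'I_n].

Lemma std_invK : pcancel (@std alpha) std_inv.
Proof.
move=> x; rewrite /std_inv (_ : map _ _ = x) ?valK //.
apply: (@eq_from_nth _ 0); first by rewrite size_map size_enum_ord multiperm_size.
rewrite size_map size_enum_ord => p pn.
rewrite (nth_map (Ordinal pn)) ?size_enum_ord // permE /= nth_enum_ord //.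
exact: letter_std.
Qed.

HB.instance Definition _ := isFinite.Build T (pcan_enumP std_invK).

Lemma std_inj : injective (@std alpha).
Proof. exact: pcan_inj std_invK. Qed.

Lemma std_val_pos x (i : 'I_n) : std_val x ((std x)^-1%g i) = i.
Proof. by have := permKV (std x) i; rewrite permE => /(congr1 val). Qed.

(** Values are counted from 0; [pos x] is the identity on the junk values [n <= i]. *)
Definition pos x (i : nat) : nat :=
  if insub i is Some o then (std x)^-1%g o else i.

Lemma posE x (i : 'I_n) : pos x i = (std x)^-1%g i.
Proof. by rewrite /pos valK. Qed.

Lemma pos_out x i : n <= i -> pos x i = i.
Proof. by move=> h; rewrite /pos insubF // ltnNge h. Qed.

Lemma pos_lt x i : i < n -> pos x i < n.
Proof. by move=> h; rewrite -[i]/(val (Ordinal h)) posE. Qed.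

Lemma pos_inj x : injective (pos x).
Proof.
have H i j : i < n -> n <= j -> pos x i <> pos x j.
  by move=> h1 h2; rewrite (pos_out x h2); have := pos_lt x h1; lia.
move=> i j E; case: (ltnP i n) (ltnP j n) => hi [] hj.
- move: E; rewrite -[i]/(val (Ordinal hi)) -[j]/(val (Ordinal hj)) !posE.
  by move/val_inj/perm_inj ->.
- by case: (H _ _ hi hj).
- by case: (H _ _ hj hi).
- by move: E; rewrite !pos_out.
Qed.

(** If [i.+1] is not a partial sum, the values [i] and [i.+1] number two copies of one letter, from
    left to right. *)
Lemma pos_noncut x i : i.+1 < n -> i.+1 \notin Jcompl alpha -> pos x i < pos x i.+1.
Proof.
move=> hi hc; have hi' : i < n by lia.
rewrite -[i]/(val (Ordinal hi')) -[i.+1]/(val (Ordinal hi)) !posE.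
set p := (std x)^-1%g (Ordinal hi'); set p' := (std x)^-1%g (Ordinal hi).
have Ep : std_val x p = i by rewrite std_val_pos.
have Ep' : std_val x p' = i.+1 by rewrite std_val_pos.
have h1 := std_val_lt x (ltn_ord p); have h2 := std_val_lt x (ltn_ord p').
have l2 : nth 0 x p' \in (x : seq nat) by rewrite mem_nth // multiperm_size.
have l1 : nth 0 x p \in (x : seq nat) by rewrite mem_nth // multiperm_size.
have {l1 l2} := (multiperm_letter l1, multiperm_letter l2).
move: h1 h2; rewrite Ep Ep'; move: Ep Ep'; rewrite /std_val.
case: (ltngtP (nth 0 x p) (nth 0 x p')) => h; last first.
- rewrite h => E1 E2 _ _ _; rewrite ltnNge; apply/negP => h3.
  have : count_mem (nth 0 x p') (take p' x) <= count_mem (nth 0 x p') (take p x).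
    by rewrite -[take p x](cat_take_drop p') take_takel // count_cat leq_addr.
  by lia.
- have := @sumn_take_le alpha (nth 0 x p') (nth 0 x p).-1 ltac:(lia); lia.
- have := @sumn_take_le alpha (nth 0 x p) (nth 0 x p').-1 ltac:(lia).
  move=> h1 h2 h3 h4 h5 [l1 l2].
  case/negP: hc; rewrite cutE hi /=; apply/mapP; exists (nth 0 x p); last by lia.
  by rewrite mem_iota; lia.
Qed.

Section Sorting.
Variable key : nat -> nat.
Hypothesis key_inj : {in gtn n &, injective key}.
Hypothesis key_noncut :
  forall i, i.+1 < n -> i.+1 \notin Jcompl alpha -> key i < key i.+1.

Let s := sort (relpre key leq) (iota 0 n).

Let mem_s i : (i \in s) = (i < n).
Proof. by rewrite mem_sort mem_iota. Qed.

Let uniq_s : uniq s. Proof. by rewrite sort_uniq iota_uniq. Qed.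

Let size_s : size s = n. Proof. by rewrite size_sort size_iota. Qed.

Let index_s i j : i < n -> j < n -> (index i s < index j s) = (key i < key j).
Proof.
have tr : transitive (relpre key leq) by move=> a b c /=; apply: leq_trans.
have so : sorted (relpre key leq) s by apply: sort_sorted => a b; apply: leq_total.
suff H a b : a < n -> b < n -> index a s < index b s -> key a < key b.
  move=> hi hj; apply/idP/idP; first exact: H.
  case: (ltngtP (index i s) (index j s)) => //; first by move/(H _ _ hj hi); lia.
  by move/index_inj ->; rewrite ?ltnn // mem_s.
move=> ha hb hl; have := @sorted_ltn_index _ (relpre key leq) tr s so a b.
rewrite !mem_s => /(_ ha hb hl) /=; rewrite leq_eqVlt => /orP[/eqP|//].
by move/(key_inj ha hb) => E; move: hl; rewrite E ltnn.
Qed.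

Let key_block c i j : 0 < c <= size alpha ->
  sumn (take c.-1 alpha) <= i -> i < j -> j < sumn (take c alpha) -> key i < key j.
Proof.
move=> hc h1 hij h2; have hn : sumn (take c alpha) <= n.
  by rewrite -[X in _ <= sumn X](cat_take_drop c) sumn_cat leq_addr.
elim: j hij h2 => // j IH hij h2.
have hj : key j < key j.+1.
  apply: key_noncut; first by lia.
  rewrite cutE; apply/negP => /andP[_ /mapP[d]]; rewrite mem_iota => hd E.
  have := @sumn_take_le alpha d c.-1; have := @sumn_take_le alpha c d; lia.
move: hij; rewrite ltnS leq_eqVlt => /orP[/eqP->//|hl].
by apply: ltn_trans hj; apply: IH => //; lia.
Qed.

Let word := [seq letter i | i <- s].

Let is_multiperm_word : is_multiperm alpha word.
Proof.
rewrite /is_multiperm size_map size_s eqxx /=; apply/allP => c; rewrite mem_iota => hc.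
rewrite count_map; have hc' : 0 < c <= size alpha by lia.
have hn : sumn (take c alpha) <= n.
  by rewrite -[X in _ <= sumn X](cat_take_drop c) sumn_cat leq_addr.
have -> : count (preim letter (pred1 c)) s
   = count (preim letter (pred1 c)) (iota 0 n) by apply/seq.permP/permEl/perm_sort.
rewrite -size_filter.
have E : sumn (take c alpha) = sumn (take c.-1 alpha) + nth 0 alpha c.-1.
  by rewrite -{1}(prednK (n := c)) 1?(take_nth 0) ?sumn_rcons //; lia.
suff /perm_size -> : perm_eq [seq x <- iota 0 n | preim letter (pred1 c) x]
   (iota (sumn (take c.-1 alpha)) (nth 0 alpha c.-1)) by rewrite size_iota.
apply: uniq_perm; rewrite ?filter_uniq ?iota_uniq // => i.
rewrite mem_filter !mem_iota /= add0n; case: (ltnP i n) => hi; last by rewrite andbF; lia.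
by rewrite letter_eq // E; lia.
Qed.

(** Conversely to [pos_noncut], any order of the values that increases within the blocks comes from
    a multipermutation: list the values by increasing key and replace each by its letter. *)
Lemma sort_multiperm :
  exists x : T, forall i j, i < n -> j < n -> (pos x i < pos x j) = (key i < key j).
Proof.
pose x : T := Multiperm is_multiperm_word.
have E p : p < n -> std_val x p = nth 0 s p.
  move=> hp; rewrite /std_val /= (nth_map 0) ?size_s // -map_take count_map -size_filter.
  set i := nth 0 s p; have hi : i < n by rewrite -mem_s mem_nth ?size_s.
  have [l1 l2 l3] := letterP hi.
  (* The earlier copies of the letter of [i] come from the smaller values of its block, because the
     key increases along the block. *)
  suff /perm_size -> : perm_eq [seq x <- take p s | preim letter (pred1 (letter i)) x]
    (iota (sumn (take (letter i).-1 alpha)) (i - sumn (take (letter i).-1 alpha))).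
    by rewrite size_iota; lia.
  apply: uniq_perm; rewrite ?filter_uniq ?iota_uniq ?take_uniq // => j.
  rewrite mem_filter mem_iota -[preim _ _ _]/(letter j == letter i).
  have hl : 0 < letter i <= size alpha by [].
  have Ei : index i s = p by rewrite index_uniq ?size_s.
  apply/andP/idP => [[/eqP El jt]|hj].
    have js : j \in s := mem_take jt.
    have jn : j < n by rewrite -mem_s.
    have := letter_eq jn hl; rewrite El eqxx => /esym/andP[h1 h2].
    rewrite h1 subnKC //=.
    move: jt; rewrite in_take // -Ei index_s // => hk.
    case: (ltngtP i j) => // [ij|Eij]; last by rewrite Eij ltnn in hk.
    by have := key_block hl l2 ij h2; lia.
  have jn : j < n by lia.
  split; first by rewrite /= letter_eq //; lia.
  rewrite in_take ?mem_s // -Ei index_s //; apply: (@key_block (letter i)) => //; lia.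
exists x => i j hi hj; suff P k : k < n -> pos x k = index k s by rewrite !P // index_s.
move=> hk; have hx : index k s < n by rewrite -size_s index_mem mem_s.
rewrite -[k in pos x k]/(val (Ordinal hk)) posE.
have -> : Ordinal hk = std x (Ordinal hx).
  by apply/val_inj; rewrite permE /= E // nth_index // mem_s.
by rewrite permK.
Qed.

End Sorting.
End Multipermutations.

(** * Graded distributive lattices *)

Import Order.LTheory.

Definition lattice_ops (T : Type) (r : rel T) (meet join : T -> T -> T) : Prop :=
  [/\ forall x y z, r z (meet x y) = r z x && r z y,
      forall x y z, r (join x y) z = r x z && r y z
    & forall x y z, meet x (join y z) = join (meet x y) (meet x z)].

Lemma distributive_lattice_ops (T : Type) (r : rel T) :
  distributive_lattice r -> exists meet join, lattice_ops r meet join.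
Proof.
case=> d [L [f [[g fK gK] rE]]].
exists (fun x y => g (f x `&` f y)%O), (fun x y => g (f x `|` f y)%O).
split=> x y z; rewrite ?rE !gK; first exact: lexI.
  exact: leUx.
by rewrite meetUr.
Qed.

Section GradedLattice.
Variables (T : finType) (r : rel T) (meet join : T -> T -> T).
Variables (len : T -> nat) (bot : T).
Hypothesis po : partial_order r.
Hypothesis lat : lattice_ops r meet join.
Hypothesis len_lt : forall x y, r x y -> x = y \/ len x < len y.
Hypothesis len_bot : len bot = 0.
Hypothesis le_bot : forall x, r bot x.
Hypothesis len_pred :
  forall y, y != bot -> exists2 x, r x y & len y = (len x).+1.

Let rxx : reflexive r. Proof. by case: po. Qed.
Let r_anti : antisymmetric r. Proof. by case: po. Qed.
Let r_trans : transitive r. Proof. by case: po. Qed.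

Lemma le_meet x y z : r z (meet x y) = r z x && r z y. Proof. by case: lat. Qed.
Lemma join_le x y z : r (join x y) z = r x z && r y z. Proof. by case: lat. Qed.
Lemma meet_joinr x y z : meet x (join y z) = join (meet x y) (meet x z).
Proof. by case: lat. Qed.

Lemma meet_lel x y : r (meet x y) x.
Proof. by have := le_meet x y (meet x y); rewrite rxx => /esym/andP[]. Qed.
Lemma meet_ler x y : r (meet x y) y.
Proof. by have := le_meet x y (meet x y); rewrite rxx => /esym/andP[]. Qed.
Lemma le_joinl x y : r x (join x y).
Proof. by have := join_le x y (join x y); rewrite rxx => /esym/andP[]. Qed.
Lemma le_joinr x y : r y (join x y).
Proof. by have := join_le x y (join x y); rewrite rxx => /esym/andP[]. Qed.

Lemma meet_idl x y : r x y -> meet x y = x.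
Proof.
by move=> h; apply/r_anti; rewrite meet_lel le_meet rxx h.
Qed.

Lemma joinC x y : join x y = join y x.
Proof. by apply/r_anti; rewrite !join_le !le_joinl !le_joinr. Qed.

Lemma meetC x y : meet x y = meet y x.
Proof. by apply/r_anti; rewrite !le_meet !meet_lel !meet_ler. Qed.

Lemma join_idr x y : r x y -> join x y = y.
Proof. by move=> h; apply/r_anti; rewrite le_joinr join_le rxx h. Qed.

Lemma join_bot x : join x bot = x.
Proof. by rewrite joinC join_idr. Qed.

Lemma join_meetr x y z : join x (meet y z) = meet (join x y) (join x z).
Proof.
apply/r_anti; rewrite !le_meet !join_le !le_joinl /=.
rewrite (r_trans (meet_lel _ _) (le_joinr _ _)) (r_trans (meet_ler _ _) (le_joinr _ _)) /=.
rewrite meet_joinr join_le (r_trans (meet_ler _ _) (le_joinl _ _)) /=.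
rewrite meetC meet_joinr join_le (r_trans (meet_ler _ _) (le_joinl _ _)) /=.
by rewrite meetC le_joinr.
Qed.

Lemma le_len x y : r x y -> len x <= len y.
Proof. by case/len_lt=> [->|/ltnW]. Qed.

Lemma le_len_eq x y : r x y -> len y <= len x -> x = y.
Proof. by case/len_lt => // h; rewrite leqNgt h. Qed.

Let prime p := (p != bot) && [forall x, forall y, r p (join x y) ==> r p x || r p y].
Let below x := [set p | prime p && r p x].

Let cover_prime x y : r x y -> x != y -> exists2 p, prime p & r p y && ~~ r p x.
Proof.
move=> xy ne; have hy : r y y && ~~ r y x.
  by rewrite rxx; apply/negP => yx; case/eqP: ne; apply/r_anti; rewrite xy.
(* An element of least length below [y] but not below [x] is join-prime: its meet with an element
   not above it is shorter, hence below [x]. *)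
case: (@arg_minnP _ y (fun q => r q y && ~~ r q x) len hy) => p /andP[py px] hp.
exists p; last by rewrite py.
rewrite /prime; apply/andP; split; first by apply: contraNneq px => ->.
apply/forallP => u; apply/forallP => v; apply/implyP => puv.
have H w : ~~ r p w -> r (meet p w) x.
  move=> pw; apply/negPn/negP => h.
  have := hp (meet p w); rewrite h (r_trans (meet_lel p w) py) => /(_ isT) hl.
  by case/negP: pw; rewrite -(le_len_eq (meet_lel p w) hl) meet_ler.
apply/negPn/negP; rewrite negb_or => /andP[/H pu /H pv]; case/negP: px.
by rewrite -(meet_idl puv) meet_joinr join_le pu pv.
Qed.

Let primeP p x y : prime p -> r p (join x y) = r p x || r p y.
Proof.
case/andP=> _ /forallP/(_ x)/forallP/(_ y)/implyP h; apply/idP/idP => [//|].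
by case/orP => h2; rewrite (r_trans h2) ?le_joinl ?le_joinr.
Qed.

(** Birkhoff's representation: the length counts the join-primes below [x]. Along a cover exactly
    one is added: if [p] and [q] are both new, then [p] is below [join y q], hence below [q], and
    conversely. *)
Let card_below x : #|below x| = len x.
Proof.
have [m] := ubnP (len x); elim: m x => // m IH x; rewrite ltnS => hm.
case: (eqVneq x bot) => [->|ne].
  rewrite len_bot; apply/eqP; rewrite cards_eq0; apply/eqP/setP => p.
  rewrite !inE; apply/negbTE/negP => /andP[/andP[/eqP pb _]] h.
  by case: pb; apply/r_anti; rewrite h le_bot.
have [y yx E] := len_pred ne.
have ne' : y != x by apply: contra_eqN E => /eqP->; rewrite neq_ltn ltnSn.
have [p pp /andP[px py]] := cover_prime yx ne'.
rewrite E -(IH y); last by rewrite -E.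
have join_eq q : r q x -> ~~ r q y -> join y q = x.
  move=> qx qy; have jx : r (join y q) x by rewrite join_le yx.
  apply: le_len_eq => //; rewrite E.
  case: (len_lt (le_joinl y q)) => // h; case/negP: qy; rewrite h; exact: le_joinr.
have -> : below x = p |: below y.
  apply/setP => q; rewrite !inE; apply/andP/orP => [[qp qx]|[/eqP->|/andP[qp qy]]] //.
    case: (boolP (r q y)) => [qy|qy]; [right; exact/andP|left].
    apply/eqP/r_anti; move: (join_eq q qx qy) (join_eq p px py) => E1 E2.
    have := px; rewrite -E1 primeP // (negbTE py) => /= ->.
    by have := qx; rewrite -E2 primeP // (negbTE qy) => /= ->.
  by rewrite qp (r_trans qy yx).
by rewrite cardsU1 !inE (negbTE py) andbF.
Qed.

(** The join-primes below a join form a union, and those below a meet form an intersection. *)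
Lemma len_join_meet x y : len (join x y) + len (meet x y) = len x + len y.
Proof.
rewrite -!card_below -[RHS]cardsUI; congr (_ + _); apply: eq_card => p.
  by rewrite !inE -andb_orr; case: (boolP (prime p)) => //= pp; apply: primeP.
by rewrite !inE le_meet; case: (prime p).
Qed.

End GradedLattice.

(** * Inversions *)

Lemma card_ord_itv n c d : d <= n -> #|[set i : 'I_n | c <= i < d]| = d - c.
Proof.
move=> dn; rewrite cardsE cardE size_filter -(count_map val (fun i => c <= i < d)).
rewrite -enumT val_enum_ord -size_filter.
suff /perm_size -> : perm_eq [seq i <- iota 0 n | c <= i < d] (iota c (d - c)).
  by rewrite size_iota.
apply: uniq_perm; rewrite ?filter_uniq ?iota_uniq // => i.
by rewrite mem_filter !mem_iota; lia.
Qed.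

Section Inversions.
Variable alpha : seq nat.
Local Notation n := (sumn alpha).
Local Notation T := (multiperm alpha).
Local Notation cut k := (k \in Jcompl alpha).
Implicit Types x y : T.

Lemma cut_lt k : cut k -> 0 < k < n.
Proof. by rewrite cutE => /andP[]. Qed.

Definition inv x i j := (i < j) && (pos x j < pos x i).

Definition len x := #|[set p : 'I_n * 'I_n | inv x p.1 p.2]|.

Lemma lenE x : len x = perm_length (std x).
Proof.
rewrite -perm_lengthV; apply: eq_card => p.
by rewrite !inE /inv !posE.
Qed.

Lemma inv_lt x i j : inv x i j -> i < j < n.
Proof.
case/andP=> ij h; rewrite ij ltnNge; apply/negP => nj.
move: h; rewrite (pos_out x nj); case: (ltnP i n) => ni; last by rewrite pos_out //; lia.
by have := pos_lt x ni; lia.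
Qed.

Lemma pos_inv x i j : i < j -> (pos x i < pos x j) = ~~ inv x i j.
Proof.
move=> ij; rewrite /inv ij /= -leqNgt [RHS]leq_eqVlt; case: eqP => // /pos_inj; lia.
Qed.

Lemma inv_trans x i j k : inv x i j -> inv x j k -> inv x i k.
Proof. rewrite /inv; lia. Qed.

Lemma inv_cotrans x i j k : i < j < k -> inv x i k -> inv x i j || inv x j k.
Proof. rewrite /inv; lia. Qed.

Lemma inv_noncut x i : inv x i i.+1 -> cut i.+1.
Proof.
move=> h; apply/negPn/negP => hc; have := inv_lt h => /andP[_ hn].
by have := pos_noncut x hn hc; move: h; rewrite /inv; lia.
Qed.

Lemma card_pos x q : q <= n -> #|[set i : 'I_n | pos x i < q]| = q.
Proof.
move=> qn; rewrite -[RHS]subn0 -(@card_ord_itv n 0 q qn).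
rewrite -[RHS](card_preimset _ (@perm_inj _ (std x)^-1)).
by apply: eq_card => i; rewrite !inE posE.
Qed.

Lemma pos_card x j : j < n -> pos x j = #|[set i : 'I_n | pos x i < pos x j]|.
Proof. by move=> jn; rewrite card_pos // ltnW // pos_lt. Qed.

Lemma eq_inv x y : (forall i j, inv x i j = inv y i j) -> x = y.
Proof.
move=> E; apply: std_inj; apply: invg_inj; apply/permP => j.
apply/val_inj; rewrite /= -!posE [LHS]pos_card // [RHS]pos_card //.
apply: eq_card => i; rewrite !inE.
case: (ltngtP i j) => [ij|ji|->]; last by rewrite !ltnn.
  by rewrite !pos_inv // E.
by move: (E j i); rewrite /inv ji.
Qed.

Definition rk x k q := #|[set i : 'I_n | (k <= i) && (pos x i < q)]|.

Lemma rkE x k q : rk x k q = rank_above (std x)^-1 k q.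
Proof. by apply: eq_card => p; rewrite !inE !posE. Qed.

Definition lo x k q := #|[set i : 'I_n | (i < k) && (pos x i < q)]|.

Lemma lo_rk x k q : q <= n -> lo x k q + rk x k q = q.
Proof.
move=> qn; rewrite -[RHS](card_pos x qn) -(cardsID [set i : 'I_n | i < k]).
by congr (_ + _); apply: eq_card => i; rewrite !inE; lia.
Qed.

Lemma key_multiperm (key : nat -> nat) : {in gtn n &, injective key} ->
  (forall i, i.+1 < n -> ~~ cut i.+1 -> key i < key i.+1) ->
  exists x, forall i j, i < j < n -> inv x i j = (key j < key i).
Proof.
move=> ki kc; have [x hx] := sort_multiperm ki kc.
by exists x => i j /andP[ij jn]; rewrite /inv ij hx //; lia.
Qed.

Lemma bot_sig : {x | [forall i : 'I_n, forall j : 'I_n, ~~ inv x i j]}.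
Proof.
apply: sigW.
have [||x hx] := @key_multiperm id; [by move=> ? ?|by []|exists x].
apply/forallP => i; apply/forallP => j; apply/negP => h.
by have := hx _ _ (inv_lt h); rewrite h => /esym; have := inv_lt h; lia.
Qed.

Definition bot : T := sval bot_sig.

Lemma inv_bot i j : inv bot i j = false.
Proof.
apply/negP => h; have hij := inv_lt h; have hi : i < n by lia.
have hj : j < n by lia.
have /forallP/(_ (Ordinal hi))/forallP/(_ (Ordinal hj)) := svalP bot_sig.
by rewrite h.
Qed.

(** The values are sorted by increasing [cls], and within a class in the order
    of [x]; the default is not used when [cls] is as in [inv_arrange]. *)
Definition arrange x (cls : nat -> nat) : T :=
  odflt bot [pick y : T | [forall i : 'I_n, forall j : 'I_n,
    (i < j) ==> (inv y i j == (cls j < cls i) || (cls i == cls j) && inv x i j)]].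

Lemma inv_arrange x (cls : nat -> nat) i j :
  (forall i, i.+1 < n -> ~~ cut i.+1 -> cls i <= cls i.+1) -> i < j < n ->
  inv (arrange x cls) i j = (cls j < cls i) || (cls i == cls j) && inv x i j.
Proof.
move=> hc hij; rewrite /arrange; case: pickP => [y hy|h] /=.
  have hi : i < n by lia.
  have hj : j < n by lia.
  have := hy; move=> /forallP/(_ (Ordinal hi))/forallP/(_ (Ordinal hj)) /=.
  by case/andP: hij => -> _ /eqP.
(* Positions are less than [n], so this key compares the classes first and then the positions. *)
have keyE a b : a < n -> b < n ->
    (cls a * n + pos x a < cls b * n + pos x b)
    = (cls a < cls b) || (cls a == cls b) && (pos x a < pos x b).
  move=> an bn; have := pos_lt x an; have := pos_lt x bn => pb pa.
  case: (ltngtP (cls a) (cls b)) => [hl|hl|->] /=; last by rewrite ltn_add2l.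
    have : (cls a).+1 * n <= cls b * n by rewrite leq_mul2r hl orbT.
    by rewrite mulSn; lia.
  have : (cls b).+1 * n <= cls a * n by rewrite leq_mul2r hl orbT.
  by rewrite mulSn; lia.
have [||y hy] := @key_multiperm (fun i => cls i * n + pos x i).
- move=> a b /= an bn E; apply: (@pos_inj _ x).
  by have := keyE a b an bn; have := keyE b a bn an; rewrite E ltnn; lia.
- move=> a an ac; rewrite keyE //; last by lia.
  by have := hc a an ac; have := pos_noncut x an ac; lia.
move: (h y) => /negP[]; apply/forallP => a; apply/forallP => b; apply/implyP => ab.
rewrite hy ?ab ?ltn_ord // keyE // [inv x a b]/inv ab /=.
by rewrite (eq_sym (cls b)).
Qed.

End Inversions.

(** * Rectangles, restrictions and supports *)

Section Elements.
Variable alpha : seq nat.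
Local Notation n := (sumn alpha).
Local Notation T := (multiperm alpha).
Local Notation cut k := (k \in Jcompl alpha).
Implicit Types x y z : T.

Lemma inv_cut x i j : inv x i j -> exists2 k, cut k & i < k <= j.
Proof.
elim: j => [|j IH]; first by rewrite /inv.
move=> h; case: (boolP (cut j.+1)) => [c|nc]; first by exists j.+1 => //; have := inv_lt h; lia.
case: (ltngtP i j) => ij.
- have /orP[/IH[k ck hk]|/inv_noncut hc] := @inv_cotrans _ x i j j.+1 ltac:(lia) h.
    by exists k => //; lia.
  by rewrite hc in nc.
- by have := inv_lt h; lia.
- by move: h; rewrite ij => /inv_noncut hc; rewrite hc in nc.
Qed.

(** The smallest element in which the pairs of values of the interval [a, b)
    that are separated by an element of [S] are inverted. *)
Definition cutrev a b (S : seq nat) : T := arrange (bot alpha) (fun i =>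
  if i < a then i else if i < b then a + count (fun k => i < k) S else i + size S).

Lemma inv_cutrev a b (S : seq nat) i j : b <= n -> {subset S <= Jcompl alpha} ->
  inv (cutrev a b S) i j = [&& a <= i, j < b & has (fun k => i < k <= j) S].
Proof.
move=> bn hS; have hc u v : u <= v ->
    count (fun k => u < k) S = count (fun k => u < k <= v) S + count (fun k => v < k) S.
  move=> uv; rewrite -(@count_predUI _ (fun k => u < k <= v)).
  rewrite [X in _ = _ + X](eq_count (a2 := pred0)) ?count_pred0 ?addn0.
    by apply: eq_count => k /=; lia.
  by move=> k /=; lia.
have hcls u : u.+1 < n -> ~~ cut u.+1 ->
    count (fun k => u < k) S = count (fun k => u.+1 < k) S.
  move=> un uc; rewrite (hc u u.+1) // -[RHS]add0n; congr (_ + _).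
  apply/eqP; rewrite -leqn0 leqNgt -has_count; apply/hasPn => k /hS kc.
  by apply: contra uc => h; rewrite (_ : u.+1 = k) //; lia.
case: (boolP (i < j < n)) => [hij|h]; last first.
  transitivity false; first by apply: contraNF h; apply: inv_lt.
  apply/esym/negbTE; apply: contra h => /and3P[_ jb /hasP[k _ hk]]; lia.
rewrite inv_arrange //; last first.
  move=> u un uc /=; rewrite (hcls u un uc); have := count_size (fun k => u.+1 < k) S.
  by repeat case: ifP; lia.
rewrite inv_bot andbF orbF /= (has_count _ S).
have := hc i j ltac:(lia); have := count_size (fun k => i < k) S; have := count_size (fun k => j < k) S.
by repeat case: ifP; lia.
Qed.

Definition rect a k b : T := cutrev a b [:: k].

Lemma inv_rect a k b i j : b <= n -> cut k ->
  inv (rect a k b) i j = [&& a <= i, i < k, k <= j & j < b].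
Proof.
move=> bn ck; rewrite inv_cutrev // => [|l]; last by rewrite inE => /eqP->.
by rewrite /= orbF; lia.
Qed.

Definition atom k : T := rect k.-1 k k.+1.

Lemma inv_atom k i j : cut k -> inv (atom k) i j = (i == k.-1) && (j == k).
Proof. by move=> ck; have := cut_lt ck => hk; rewrite inv_rect //; lia. Qed.

(** The values of [a, b) share one class and every other value has its own, so only inversions
    within [a, b) survive. *)
Definition res x a b : T := arrange x (fun i => if a <= i < b then a else i).

Lemma inv_res x a b i j : inv (res x a b) i j = [&& a <= i, j < b & inv x i j].
Proof.
case: (boolP (i < j < n)) => [hij|h]; last first.
  transitivity false; first by apply: contraNF h; apply: inv_lt.
  by apply/esym; apply: contraNF h => /and3P[_ _ /inv_lt].
rewrite inv_arrange //; last by move=> u _ _ /=; repeat case: ifP; lia.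
by rewrite /=; repeat case: ifP; case: (inv x i j); lia.
Qed.

(** The values of [k, b) are put before those of [a, k). For [x] supported in [a, b) this is an
    upper bound of [x] in the weak order. *)
Definition separate x a k b : T := arrange x (fun i =>
  if k <= i < b then a else if a <= i < k then a.+1 else i).

Lemma inv_separate x a k b i j : a < k < b -> b <= n -> cut k ->
  inv (separate x a k b) i j = [|| inv (rect a k b) i j, inv (res x a k) i j | inv (res x k b) i j].
Proof.
move=> akb bn ck; rewrite (@inv_rect a k b) // (inv_res x a k) (inv_res x k b).
case: (boolP (i < j < n)) => [hij|h]; last first.
  have -> : inv x i j = false by apply: contraNF h; apply: inv_lt.
  rewrite !andbF !orbF; transitivity false.
    by apply: contraNF h; apply: inv_lt.
  by apply/esym; apply: contraNF h; lia.
rewrite inv_arrange //; last first.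
  move=> u _ uc /=; have uk : u.+1 <> k by move=> E; rewrite E ck in uc.
  by repeat case: ifP; lia.
by rewrite /=; repeat case: ifP; case: (inv x i j); lia.
Qed.

Definition inside a b x := forall i j, inv x i j -> a <= i /\ j < b.

Lemma inside_cutrev a b (S : seq nat) : b <= n -> {subset S <= Jcompl alpha} ->
  inside a b (cutrev a b S).
Proof. by move=> bn hS i j; rewrite inv_cutrev // => /and3P[]. Qed.

Lemma inside_rect a k b : b <= n -> cut k -> inside a b (rect a k b).
Proof. by move=> bn ck i j; rewrite inv_rect // => /and4P[]. Qed.

Lemma inside_res x a b : inside a b (res x a b).
Proof. by move=> i j; rewrite inv_res => /and3P[]. Qed.

Lemma res_inside x a b : inside a b x -> res x a b = x.
Proof.
move=> h; apply: eq_inv => i j; rewrite inv_res; case: (boolP (inv x i j)) => [/h|_]; lia.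
Qed.

Lemma res_res x a b c d : a <= c -> d <= b -> res (res x a b) c d = res x c d.
Proof. by move=> ac db; apply: eq_inv => i j; rewrite !inv_res; case: (inv x i j); lia. Qed.

Definition top a b : T := cutrev a b (Jcompl alpha).

Lemma inv_top a b i j : b <= n ->
  inv (top a b) i j = [&& a <= i, j < b & has (fun k => i < k <= j) (Jcompl alpha)].
Proof. by move=> bn; apply: inv_cutrev. Qed.

Lemma inv_le_top a b x : b <= n -> inside a b x -> forall i j, inv x i j -> inv (top a b) i j.
Proof.
move=> bn h i j hij; rewrite inv_top //; have [ai jb] := h _ _ hij.
by rewrite ai jb; apply/hasP; have [k] := inv_cut hij; exists k.
Qed.

Lemma pos_ge x j (A : {set 'I_n}) :
  (forall i : 'I_n, i \in A -> pos x i < pos x j) -> #|A| <= pos x j.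
Proof.
move=> h; case: (ltnP j n) => [jn|nj]; last first.
  by rewrite pos_out //; apply: leq_trans nj; rewrite -[X in _ <= X]card_ord max_card.
rewrite (pos_card x jn); apply/subset_leq_card/subsetP => i iA; rewrite inE; exact: h.
Qed.

Lemma pos_le x j (A : {set 'I_n}) : j < n ->
  (forall i : 'I_n, pos x i < pos x j -> i \in A) -> pos x j <= #|A|.
Proof.
by move=> jn h; rewrite (pos_card x jn); apply/subset_leq_card/subsetP => i; rewrite inE; apply: h.
Qed.

(** Before the value [i] come at most [i] smaller values, and only those larger ones that are
    inverted with it. *)
Lemma pos_le_add x i l b : b <= n -> (forall j, inv x i j -> l <= j < b) -> i < n ->
  pos x i <= i + (b - l).
Proof.
move=> bn h ni; apply: leq_trans (_ : #|[set j : 'I_n | 0 <= j < i] :|: [set j : 'I_n | l <= j < b]| <= _).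
  apply: pos_le => // j hj; rewrite !inE /=; case: (ltngtP i j) => ij //.
    by rewrite h // /inv ij.
  by rewrite ij ltnn in hj.
apply: leq_trans (leq_card_setU _ _) _.
by rewrite !card_ord_itv //; lia.
Qed.

Lemma pos_ge_add x j a k l : l <= n -> a <= k <= l ->
  (forall i, i < a \/ k <= i < l -> pos x i < pos x j) -> a + (l - k) <= pos x j.
Proof.
move=> ln akl h; apply: leq_trans (_ : #|[set i : 'I_n | 0 <= i < a] :|: [set i : 'I_n | k <= i < l]| <= _).
  rewrite cardsU !card_ord_itv //; last lia.
  suff -> : [set i : 'I_n | 0 <= i < a] :&: [set i : 'I_n | k <= i < l] = set0 by rewrite cards0; lia.
  by apply/setP => i; rewrite !inE; lia.
by apply: pos_ge => i; rewrite !inE => /orP hi; apply: h; case: hi; lia.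
Qed.

Lemma lo_full x k q : k <= n -> lo x k q = k -> forall i, i < k -> pos x i < q.
Proof.
move=> kn E i ik; have := @card_ord_itv n 0 k kn; rewrite subn0 => E2.
have : [set i : 'I_n | (i < k) && (pos x i < q)] = [set i : 'I_n | 0 <= i < k].
  apply/eqP; rewrite eqEcard E2 -[X in X <= _]E leqnn andbT.
  by apply/subsetP => j; rewrite !inE => /andP[].
move/setP/(_ (Ordinal (leq_trans ik kn))); rewrite !inE /= ik /=; lia.
Qed.

Lemma lo_le x k q : k <= n -> lo x k q <= k.
Proof.
move=> kn; rewrite -[X in _ <= X]subn0 -(@card_ord_itv n 0 k kn).
by apply/subset_leq_card/subsetP => i; rewrite !inE => /andP[].
Qed.

Lemma full_lo x k q : k <= n -> (forall i, i < k -> pos x i < q) -> lo x k q = k.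
Proof.
move=> kn h; rewrite -[RHS]subn0 -(@card_ord_itv n 0 k kn).
apply: eq_card => i; rewrite !inE /=; case: ltnP => //= hi; exact: h.
Qed.

Lemma rk0P x d q : reflect (forall j, j < n -> d <= j -> q <= pos x j) (rk x d q == 0).
Proof.
rewrite cards_eq0; apply: (iffP eqP) => [/setP h j jn dj|h].
  by have := h (Ordinal jn); rewrite !inE /= dj /=; lia.
by apply/setP => j; rewrite !inE; apply/negbTE/negP => /andP[/(h j (ltn_ord j))]; lia.
Qed.

Definition nocross k x := forall i j, i < k <= j -> ~~ inv x i j.

(** Without inversions across [k], the first [k] letters are the values less than [k]. As a
    condition on ranks, this passes to smaller elements of the Bruhat order. *)
Lemma nocrossP k x : k <= n -> nocross k x <-> rk x k k = 0.
Proof.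
move=> kn; split=> [h|/eqP/rk0P h i j /andP[ik kj]].
  apply/eqP/rk0P => j jn kj; rewrite leqNgt; apply/negP => jk.
  have := lo_le x k kn; rewrite leq_eqVlt => /orP[/eqP E|].
    have := lo_rk x k kn; rewrite E => E2.
    have /rk0P/(_ j jn kj) : rk x k k == 0 by lia.
    by lia.
  rewrite ltnNge => /negP; apply; rewrite -[X in X <= _](@full_lo x k k) // => i ik.
  by have := h i j; rewrite ik kj /inv => /(_ isT); lia.
apply/negP => hi; have := inv_lt hi => /andP[_ jn]; have := h j jn kj.
have E : lo x k k = k.
  by have := lo_rk x k kn; have : rk x k k == 0 by [apply/rk0P]; lia.
by have := lo_full kn E ik; move: hi; rewrite /inv; lia.
Qed.

(** The hypotheses force the first [q] letters to be the values of [0, c) and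
    of [m, d). *)
Lemma inv_of_rk z c m d : c <= m <= d -> d <= n -> let q := c + (d - m) in
  (forall i, i < c -> pos z i < q) -> (forall j, j < n -> d <= j -> q <= pos z j) ->
  d - m <= rk z m q -> forall i j, c <= i < m -> m <= j < d -> inv z i j.
Proof.
move=> cmd dn q h1 h2 h3 i j hi hj.
have qn : q <= n by rewrite /q; lia.
set A := [set i : 'I_n | (m <= i) && (pos z i < q)].
have E : A = [set i : 'I_n | m <= i < d].
  apply/eqP; rewrite eqEcard card_ord_itv // h3 andbT; apply/subsetP => v.
  rewrite !inE => /andP[-> hv] /=; rewrite ltnNge; apply/negP => dv.
  by have := h2 v (ltn_ord v) dv; lia.
have jn : j < n by lia.
have /setP/(_ (Ordinal jn)) := E; rewrite !inE /= hj => /andP[_ pj].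
have Er : rk z m q = d - m by rewrite -(@card_ord_itv n m d dn) -E.
have El : lo z m q = c by have := lo_rk z m qn; rewrite Er /q; lia.
have ein : i < n by lia.
suff : q <= pos z i by rewrite /inv; lia.
rewrite leqNgt; apply/negP => pi.
have : [set i : 'I_n | 0 <= i < c] = [set i : 'I_n | (i < m) && (pos z i < q)].
  apply/eqP; rewrite eqEcard card_ord_itv ?subn0; last by lia.
  rewrite -[X in X <= _]/(lo z m q) El leqnn andbT; apply/subsetP => v.
  by rewrite !inE /= => vc; rewrite h1 // andbT; lia.
by move/setP/(_ (Ordinal ein)); rewrite !inE /= pi; lia.
Qed.

End Elements.

(** * Inversions across a cut and rank functions *)

Lemma card_sum (I : finType) (P : pred I) : #|[set i | P i]| = \sum_i P i.
Proof. by rewrite -sum1dep_card big_mkcond; apply: eq_bigr => i _; case: (P i). Qed.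

Section Crossings.
Variables (alpha : seq nat) (k : nat).
Local Notation n := (sumn alpha).
Local Notation T := (multiperm alpha).
Implicit Types x y : T.

Definition crossings x := #|[set p : 'I_n * 'I_n | (p.1 < k <= p.2) && inv x p.1 p.2]|.

(** The sum counts the pairs of a value [i] at least [k] and a value [j] at the same position or
    later. Those with [j < k] are the crossings. The others, once doubled and symmetrized, have a
    count that does not depend on [x]. *)
Lemma sum_rk x : (\sum_(q < n.+1) rk x k q) * 2 = crossings x * 2 +
  \sum_(i < n) \sum_(j < n) (((k <= i) && (k <= j)) + ((k <= i) && (i == j))).
Proof.
have E1 : \sum_(q < n.+1) rk x k q
    = \sum_(i < n) \sum_(j < n) ((k <= i) && (pos x i <= pos x j)).
  under eq_bigr do rewrite /rk card_sum.
  rewrite exchange_big; apply: eq_bigr => i _; case: (k <= i) => /=; last by rewrite !big1.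
  rewrite -!card_sum; have pi := pos_lt x (ltn_ord i).
  have -> : #|[set q : 'I_n.+1 | pos x i < q]| = n.+1 - (pos x i).+1.
    by rewrite -(card_ord_itv _ (leqnn n.+1)); apply: eq_card => q; rewrite !inE ltn_ord andbT.
  have := cardsC [set j : 'I_n | pos x j < pos x i]; rewrite card_ord card_pos; last exact: ltnW.
  rewrite subSS => E; apply/eqP; rewrite -(eqn_add2l (pos x i)) subnKC; last exact: ltnW.
  rewrite -[X in X == _]E; apply/eqP; congr (_ + _); apply: eq_card => j; rewrite !inE; lia.
pose e (i j : 'I_n) : nat := [&& k <= i, k <= j & pos x i <= pos x j].
have E2 : \sum_(i < n) \sum_(j < n) ((k <= i) && (pos x i <= pos x j) : nat)
    = crossings x + \sum_(i < n) \sum_(j < n) e i j.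
  rewrite /crossings card_sum -(pair_bigA _ (fun i j : 'I_n => (i < k <= j) && inv x i j : nat)) /=.
  rewrite [X in _ = X + _]exchange_big -big_split; apply: eq_bigr => i _ /=.
  rewrite -big_split; apply: eq_bigr => j _ /=; rewrite /e /inv.
  have := @pos_inj _ x i j; case: (ltngtP j i) => ji h; lia.
rewrite E1 E2 mulnDl; congr (_ + _); rewrite muln2 -addnn.
rewrite {2}exchange_big -big_split; apply: eq_bigr => i _ /=.
rewrite -big_split; apply: eq_bigr => j _ /=; rewrite /e -val_eqE /=.
have := @pos_inj _ x i j; case: (ltngtP i j) => ij h; try lia.
by rewrite ij; lia.
Qed.

(** By [sum_rk] the number of crossings determines the sum of the ranks, so a termwise inequality
    whose sums are ordered the other way is an equality. *)
Lemma rk_eq x y : (forall q, rk x k q <= rk y k q) -> crossings y <= crossings x ->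
  forall q, q <= n -> rk x k q = rk y k q.
Proof.
move=> h hc q qn; have := sum_rk x; have := sum_rk y => Ey Ex.
have : \sum_(q < n.+1) (rk y k q - rk x k q) = 0.
  rewrite sumnB => [|i _]; last exact: h.
  move: Ex Ey; set K := \sum_(i < n) _; set X := \sum_(q < _) _; set Y := \sum_(q < _) _.
  by clearbody K X Y; lia.
move/eqP; rewrite sum_nat_eq0 => /forallP/(_ (inord q)); rewrite /= inordK // => /eqP.
by have := h q; lia.
Qed.

(** Elements without inversions on either side of [k] are compared like the
    words in two letters that they shuffle. *)
Lemma inv_of_rk_le x y : (forall i j, inv x i j -> i < k <= j) ->
  (forall i j, inv y i j -> i < k <= j) -> (forall q, q <= n -> rk x k q <= rk y k q) ->
  forall i j, inv x i j -> inv y i j.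
Proof.
move=> hx hy hr i j hij; have /andP[ik kj] := hx _ _ hij.
have /andP[ij jn] := inv_lt hij; apply/negPn/negP => nij.
have pij : pos y i < pos y j by rewrite pos_inv.
have ein : i < n by lia.
(* The prefix of [y] that ends with [i] does not contain [j]. By the ranks, the prefix of [x] of the
   same length contains [i], hence the earlier [j], and so more values at least [k] than that of
   [y]. *)
set q := (pos y i).+1; have qn : q <= n by exact: pos_lt.
have mono (z : T) u v : (forall i j, inv z i j -> i < k <= j) ->
    u <= v -> (v < k) || (k <= u) -> pos z u <= pos z v.
  move=> hz; rewrite leq_eqVlt => /orP[/eqP->//|uv] huv.
  by apply: ltnW; rewrite pos_inv //; apply/negP => /hz; lia.
have l1 : i < lo y k q.
  rewrite -[X in X <= _]subn0 -(@card_ord_itv n 0 i.+1 ein).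
  apply/subset_leq_card/subsetP => u; rewrite !inE /= => ui.
  have -> : u < k by lia.
  by rewrite ltnS; apply: mono => //; lia.
have l2 : i < lo x k q.
  by have := hr q qn; have := lo_rk x k qn; have := lo_rk y k qn; lia.
have pxi : pos x i < q.
  rewrite ltnNge; apply/negP => h; move: l2; rewrite ltnNge => /negP; apply.
  rewrite -[X in _ <= X]subn0 -(@card_ord_itv n 0 i (ltnW ein)).
  apply/subset_leq_card/subsetP => u; rewrite !inE /= => /andP[uk pu].
  rewrite ltnNge; apply/negP => iu.
  by have := mono x i u hx iu; rewrite uk => /(_ isT); lia.
have r1 : j.+1 - k <= rk x k q.
  rewrite -(@card_ord_itv n k j.+1 jn).
  apply/subset_leq_card/subsetP => u; rewrite !inE => /andP[ku uj]; rewrite ku /=.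
  have := mono x u j hx uj; rewrite ku orbT => /(_ isT).
  by case/andP: hij => _; lia.
have r2 : rk y k q <= j - k.
  rewrite -(@card_ord_itv n k j (ltnW jn)).
  apply/subset_leq_card/subsetP => u; rewrite !inE => /andP[ku pu]; rewrite ku /=.
  rewrite ltnNge; apply/negP => ju; have := mono y j u hy ju; rewrite kj orbT => /(_ isT).
  by move: pu; rewrite /q; lia.
by have := hr q qn; lia.
Qed.

End Crossings.

(** * Shapes of shuffles *)

(** The subword of a prefix is a prefix of the subword, so that letters of a subword are located by
    counting in prefixes. *)
Lemma index_nth_filter (w : seq nat) (P : pred nat) i q : uniq w -> i < count P w ->
  (index (nth 0 (filter P w) i) w < q) = (i < count P (take q w)).
Proof.
move=> uw hi; set v := nth _ _ _.
have hs : i < size (filter P w) by rewrite size_filter.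
have : v \in filter P w by apply: mem_nth.
rewrite mem_filter => /andP[Pv vw].
rewrite -in_take // -size_filter.
have E : filter P w = filter P (take q w) ++ filter P (drop q w).
  by rewrite -filter_cat cat_take_drop.
have Ev : (v \in take q w) = (v \in filter P (take q w)) by rewrite mem_filter Pv.
rewrite Ev {1}/v E nth_cat; case: ltnP => h; first by rewrite mem_nth.
apply/negbTE/negP => h1.
have : uniq (filter P w) by rewrite filter_uniq.
rewrite E cat_uniq => /and3P[_ /hasPn/(_ (nth 0 (filter P (drop q w)) (i - size (filter P (take q w)))))].
rewrite h1 mem_nth => [/(_ isT)//|].
by move: hs; rewrite E size_cat ltn_subLR.
Qed.

Section Shapes.
Variable alpha : seq nat.
Local Notation n := (sumn alpha).
Local Notation T := (multiperm alpha).
Implicit Types x y : T.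

Local Notation word x := (oneline (std x)).

Lemma uniq_word x : uniq (word x).
Proof. by rewrite map_inj_uniq ?enum_uniq // => p q [] /val_inj/perm_inj. Qed.

Definition cnt x c d q := #|[set v : 'I_n | (c <= v < d) && (pos x v < q)]|.

Lemma count_word x c d q : q <= n ->
  count (fun v => c < v <= d) (take q (word x)) = cnt x c d q.
Proof.
move=> qn; rewrite /oneline -map_take count_map.
have -> : take q (enum 'I_n) = [seq p : 'I_n <- enum 'I_n | p < q].
  apply: (inj_map val_inj); rewrite map_take -(filter_map val (fun p => p < q)) val_enum_ord.
  by rewrite take_iota (minn_idPl qn) -(filter_iota_ltn 0 qn).
rewrite count_filter /cnt -(card_preimset _ (@perm_inj _ (std x))) cardE size_filter.
rewrite enumT; apply: eq_count => p /=; rewrite !inE posE permK.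
by rewrite andbC.
Qed.

Lemma cnt_le x c d q q' : q <= q' -> cnt x c d q <= cnt x c d q'.
Proof.
move=> qq; apply/subset_leq_card/subsetP => v; rewrite !inE => /andP[-> h] /=; lia.
Qed.

Lemma cnt_max x c d q : d <= n -> cnt x c d q <= d - c.
Proof.
move=> dn; rewrite -(card_ord_itv c dn); apply/subset_leq_card/subsetP => v.
by rewrite !inE => /andP[].
Qed.

Lemma cnt_full x c d : d <= n -> cnt x c d n = d - c.
Proof.
move=> dn; rewrite -(card_ord_itv c dn); apply: eq_card => v; rewrite !inE.
by rewrite pos_lt ?ltn_ord // andbT.
Qed.

(** In the subword of the values of the interval [a, b), letter [j] of the
    upper values [k, b) precedes letter [i] of the lower values [a, k); the
    values are shifted by one in the word. *)
Definition shape x a k b i j :=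
  index (nth 0 (subword (word x) k.+1 b) j) (word x)
  < index (nth 0 (subword (word x) a.+1 k) i) (word x).

Section Shape.
Variables a k b : nat.
Hypotheses (akb : a < k < b) (bn : b <= n).

Let kn : k <= n. Proof. lia. Qed.

Lemma count_word_full x c d : d <= n -> count (fun v => c < v <= d) (word x) = d - c.
Proof.
move=> dn; rewrite -(cnt_full x c dn) -count_word // take_oversize //.
by rewrite size_map size_enum_ord.
Qed.

Lemma shape_cnt x i j : i < k - a -> j < b - k ->
  shape x a k b i j <-> exists2 q, q <= n & j < cnt x k b q /\ cnt x a k q <= i.
Proof.
move=> hi hj; rewrite /shape /subword.
set r := nth _ _ j; set l := nth _ _ i.
have hr q : q <= n -> (index r (word x) < q) = (j < cnt x k b q).
  by move=> qn; rewrite index_nth_filter ?uniq_word ?count_word_full // count_word.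
have hl q : q <= n -> (index l (word x) < q) = (i < cnt x a k q).
  by move=> qn; rewrite index_nth_filter ?uniq_word ?count_word_full // count_word.
split=> [rl|[q qn []]]; last by have := hr q qn; have := hl q qn; lia.
have rn : index r (word x) < n by rewrite hr // cnt_full.
exists (index r (word x)).+1 => //; have := hr _ rn; have := hl _ rn; lia.
Qed.

(** The separating prefix can be chosen to end with an upper value. The condition then involves only
    the relative order of the values of [a, b), which is what [shape_res] needs. *)
Lemma shape_val x i j : i < k - a -> j < b - k ->
  shape x a k b i j <-> exists2 v, k <= v < b &
    j < cnt x k b (pos x v).+1 /\ cnt x a k (pos x v).+1 <= i.
Proof.
move=> hi hj; rewrite shape_cnt //; split=> [[q qn [h1 h2]]|[v hv h]]; last first.
  by exists (pos x v).+1 => //; apply: pos_lt; lia.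
have q0 : 0 < q.
  rewrite lt0n; apply/eqP => E; move: h1; rewrite E /cnt.
  by rewrite (_ : [set _ | _] = set0) ?cards0 //; apply/setP => v; rewrite !inE andbF.
(* The shortest prefix with more than [j] upper values ends with an upper value. *)
have : exists q', (q' <= q) && (j < cnt x k b q') by exists q; rewrite leqnn.
move/ex_minnP => [p /andP[pq hp] pmin].
case: p pq hp pmin => [|p] pq hp pmin.
  by move: hp; rewrite /cnt (_ : [set _ | _] = set0) ?cards0 //; apply/setP => v; rewrite !inE andbF.
have [v hv pv] : exists2 v : 'I_n, k <= v < b & pos x v = p.
  suff /existsP[v /andP[hv /eqP pv]] : [exists v : 'I_n, (k <= v < b) && (pos x v == p)].
    by exists v.
  apply: contraT; rewrite negb_exists => /forallP h.
  have : cnt x k b p.+1 <= cnt x k b p.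
    apply/subset_leq_card/subsetP => v; rewrite !inE => /andP[hv hp'].
    by have := h v; rewrite hv /=; lia.
  by move=> h3; have := pmin p; rewrite (ltnW pq) (leq_trans hp h3) => /(_ isT); rewrite ltnn.
exists v => //; rewrite pv; split=> //; exact: leq_trans (cnt_le x a k pq) h2.
Qed.

Lemma shape_res x i j : i < k - a -> j < b - k ->
  shape (res x a b) a k b i j <-> shape x a k b i j.
Proof.
move=> hi hj; rewrite !shape_val //.
have E u v : a <= u < b -> a <= v < b ->
    (pos (res x a b) u < (pos (res x a b) v).+1) = (pos x u < (pos x v).+1).
  move=> hu hv; rewrite !ltnS [LHS]leqNgt [RHS]leqNgt; congr (~~ _).
  case: (ltngtP u v) => [uv|vu|->]; last by rewrite !ltnn.
    by have := inv_res x a b u v; rewrite /inv uv; lia.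
  by rewrite !pos_inv // inv_res; lia.
have Ec c d v : a <= c -> d <= b -> a <= v < b ->
    cnt (res x a b) c d (pos (res x a b) v).+1 = cnt x c d (pos x v).+1.
  move=> ac db hv; apply: eq_card => u; rewrite !inE; case: (boolP (c <= u < d)) => //= hu.
  by rewrite E //; lia.
by split=> -[v hv h]; exists v => //; move: h; rewrite !Ec //; lia.
Qed.

Lemma pos_fixed x v : (forall j, ~~ inv x v j) -> (forall j, ~~ inv x j v) -> pos x v = v.
Proof.
case: (ltnP v n) => [vn h1 h2|nv _ _]; last exact: pos_out.
apply/eqP; rewrite eqn_leq; apply/andP; split.
  rewrite -[X in _ <= X]addn0 -(subnn 0); apply: pos_le_add => // j hj.
  by have := h1 j; rewrite hj.
have := @pos_ge_add _ x v v n n (leqnn n); rewrite subnn addn0; apply; first by rewrite leqnn ltnW.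
move=> i hi; have iv : i < v by lia.
by rewrite pos_inv.
Qed.

Lemma cnt_rk x q : inside a b x -> q <= n -> rk x k q = cnt x k b q + (q - b).
Proof.
move=> hx qn; rewrite -(card_ord_itv b qn) /rk /cnt.
set A := [set _ | _]; rewrite -(cardsID [set v : 'I_n | v < b] A); congr (_ + _).
  by apply: eq_card => v; rewrite !inE; lia.
apply: eq_card => v; rewrite !inE -leqNgt; case: (leqP b v) => //= bv.
rewrite pos_fixed; first by lia.
  by move=> j; apply/negP => h; have := hx _ _ h; have := inv_lt h; lia.
by move=> j; apply/negP => h; have := hx _ _ h; lia.
Qed.

Lemma cnt_lo x q : inside a b x -> q <= n -> lo x k q = cnt x a k q + minn q a.
Proof.
move=> hx qn; have man : minn q a <= n by lia.
rewrite -[minn q a]subn0 -(card_ord_itv 0 man) /lo /cnt.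
set A := [set _ | _]; rewrite -(cardsID [set v : 'I_n | a <= v] A); congr (_ + _).
  by apply: eq_card => v; rewrite !inE; lia.
apply: eq_card => v; rewrite !inE -ltnNge leq_min; case: (ltnP v a) => /= va; last by rewrite andbF.
rewrite pos_fixed; first by lia.
  by move=> j; apply/negP => h; have := hx _ _ h; lia.
by move=> j; apply/negP => h; have := hx _ _ h; have := inv_lt h; lia.
Qed.

(** The shape is the diagram cut out by the lattice path that reads lower and upper values as its
    two kinds of steps; comparing ranks compares the paths. *)
Lemma rk_shape x y : inside a b x -> inside a b y ->
  (forall q, q <= n -> rk x k q <= rk y k q) <->
  (forall i j, i < k - a -> j < b - k -> shape x a k b i j -> shape y a k b i j).
Proof.
move=> hx hy; split=> [h i j hi hj|h q qn].
  rewrite !shape_cnt // => -[q qn [h1 h2]]; exists q => //; have := h q qn.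
  have := lo_rk x k qn; have := lo_rk y k qn; rewrite !cnt_lo // !cnt_rk //; lia.
rewrite leqNgt; apply/negP => lt.
have [lR lL] : cnt y k b q < cnt x k b q /\ cnt x a k q < cnt y a k q.
  have := lo_rk x k qn; have := lo_rk y k qn; move: lt; rewrite !cnt_lo // !cnt_rk //; lia.
have hi := leq_trans lL (cnt_max y a q kn).
have hj := leq_trans lR (cnt_max x k q bn).
(* The cell given by the number of lower values of [x] and the number of upper values of [y] in this
   prefix lies in the shape of [x] but not in that of [y]. *)
have := h _ _ hi hj; rewrite !shape_cnt // => -[|q' q'n [h1 h2]]; first by exists q.
case: (leqP q q') => qq.
  by have := cnt_le y a k qq; lia.
by have := cnt_le y k b (ltnW qq); lia.
Qed.

End Shape.
End Shapes.

(** * Binary search trees *)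

(** In the binary search tree of [s], whose labels lie strictly between [a] and
    [b], the subtree of [k] has its labels strictly between [a'] and [b']. *)
Definition subtree_bounds (s : seq nat) a b k a' b' : Prop :=
  let t := take (index k s) s in
  [/\ a' = a \/ a' \in t, b' = b \/ b' \in t, a' < k < b'
    & forall l, l \in t -> ~~ (a' < l < b')].

Section SubtreeBounds.
Variables (s1 s2 : seq nat) (a r b : nat).
Hypothesis arb : a < r < b.
Hypothesis h1 : forall l, l \in s1 -> a < l < r.
Hypothesis h2 : forall l, l \in s2 -> r < l < b.
Local Notation s := (r :: s1 ++ s2).

Lemma subtree_bounds_root a' b' : subtree_bounds s a b r a' b' <-> a' = a /\ b' = b.
Proof.
rewrite /subtree_bounds /= eqxx take0; split=> [[]|[-> ->]]; last by split=> //; left.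
by rewrite !in_nil => -[->|//] [->|//].
Qed.

Lemma subtree_bounds_left k a' b' : k \in s1 ->
  subtree_bounds s a b k a' b' <-> subtree_bounds s1 a r k a' b'.
Proof.
move=> ks; have hk := h1 ks; rewrite /subtree_bounds /= (_ : (r == k) = false) /=; last by lia.
have -> : take (index k (s1 ++ s2)) (s1 ++ s2) = take (index k s1) s1.
  by rewrite index_cat ks take_cat index_mem ks.
have hl l : l \in take (index k s1) s1 -> a < l < r by move/mem_take/h1.
split=> -[ha hb hab hn].
  split=> //.
  - case: ha => [->|]; first by left.
    by rewrite inE => /orP[/eqP E|]; [lia|right].
  - case: hb => [E|]; last by rewrite inE => /orP[/eqP->|]; [left|right].
    by have := hn r (mem_head _ _); lia.
  - by move=> l lt; apply: hn; rewrite inE lt orbT.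
split=> //.
- by case: ha => [->|h]; [left|right; rewrite inE h orbT].
- by right; case: hb => [->|h]; rewrite inE ?eqxx // h orbT.
- by move=> l; rewrite inE => /orP[/eqP->|/hn//]; case: hb => [->|/hl]; lia.
Qed.

(** The labels of [s1] also precede [k], but they lie beyond [r] and so do not bound its subtree. *)
Lemma subtree_bounds_right k a' b' : k \in s2 ->
  subtree_bounds s a b k a' b' <-> subtree_bounds s2 r b k a' b'.
Proof.
move=> ks; have hk := h2 ks; rewrite /subtree_bounds /= (_ : (r == k) = false) /=; last by lia.
have ks1 : k \notin s1 by apply/negP => /h1; lia.
have -> : take (index k (s1 ++ s2)) (s1 ++ s2) = s1 ++ take (index k s2) s2.
  rewrite index_cat (negbTE ks1) take_cat ltnNge leq_addr /=.
  by rewrite addKn.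
have hl l : l \in take (index k s2) s2 -> r < l < b by move/mem_take/h2.
split=> -[ha hb hab hn].
  have hr := hn r (mem_head _ _).
  split=> //.
  - case: ha => [E|]; first by lia.
    rewrite inE mem_cat => /or3P[/eqP->|/h1|]; [by left|lia|by right].
  - case: hb => [->|]; first by left.
    rewrite inE mem_cat => /or3P[/eqP E|/h1|]; [lia|lia|by right].
  - by move=> l lt; apply: hn; rewrite inE mem_cat lt !orbT.
split=> //.
- by right; case: ha => [->|h]; rewrite inE ?eqxx // mem_cat h !orbT.
- by case: hb => [->|h]; [left|right; rewrite inE mem_cat h !orbT].
- move=> l; rewrite inE mem_cat => /or3P[/eqP->|/h1|/hn//]; case: ha => [->|/hl]; lia.
Qed.

End SubtreeBounds.

(** The maximum spans the largest interval around [k] that contains no earlier label, so it stops at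
    such labels or at the ends. The bound [a] is exclusive, whence [a.+1]. *)
Lemma Rtree_max_bounds n s k a b : uniq s -> {in s, forall l, 0 < l < n} -> k \in s ->
  subtree_bounds s 0 n k a b <-> Rtree_max n (bst s) k = (a.+1, b).
Proof.
move=> us sn ks; have kn := sn k ks.
have [] := Rtree_maxP us ks kn; case: (Rtree_max _ _ _) => A B.
have inR i j : ((i, j) \in Rword n s k) = [&& 0 < i <= k, k < j <= n
    & all (fun l => ~~ (i <= l < j)) (take (index k s) s)].
  rewrite mem_filter mem_Pn /pair_le /=.
  by case: (all _ _); rewrite ?andbF //=; lia.
rewrite inR => /and3P[hA hB /allP hAB] hmax.
have le i j : (i, j) \in Rword n s k -> A <= i /\ j <= B.
  by move/hmax => /andP[].
have tn l : l \in take (index k s) s -> 0 < l < n by move/mem_take/sn.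
split=> [[ha hb hab hn]|[EA <-]].
  have h : (a.+1, b) \in Rword n s k.
    rewrite inR; apply/and3P; split; [by lia| |by apply/allP => l /hn; lia].
    by case: hb => [->|/tn]; lia.
  have [h1 h2] := le _ _ h.
  suff [-> ->] : A = a.+1 /\ B = b by [].
  split.
    case: ha => [E|/hAB]; [lia|].
    by case: (ltnP a A) => h3; lia.
  by case: hb => [E|/hAB]; lia.
split; [| |lia|by move=> l /hAB; rewrite EA; lia].
  case: (posnP a) => [->|a0]; [by left|right]; apply/negPn/negP => nt.
  have /le : (a, B) \in Rword n s k; last by lia.
  rewrite inR; apply/and3P; split; [lia|lia|apply/allP => l lt].
  have := hAB l lt; have : l != a by apply: contraNneq nt => <-.
  lia.
case: (eqVneq B n) => [->|Bn]; [by left|right]; apply/negPn/negP => nt.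
have /le : (A, B.+1) \in Rword n s k; last by lia.
rewrite inR; apply/and3P; split; [lia|lia|apply/allP => l lt].
have := hAB l lt; have : l != B by apply: contraNneq nt => <-.
lia.
Qed.

(** * Orders between the weak and Bruhat orders *)

(** Here [r] is the inversion relation of an element that has exactly one
    inversion [(i, j)] more than a rectangle. *)
Section NewPair.
Variables (r : nat -> nat -> Prop) (i j k l : nat).
Hypothesis r_trans : forall u v w, r u v -> r v w -> r u w.
Hypothesis r_cotrans : forall u v w, u < v < w -> r u w -> r u v \/ r v w.
Hypothesis rij : r i j.

(** Any other position of the new pair would produce a second new inversion, by cotransitivity at
    [l] or [k.-1], or by transitivity through an old inversion. *)
Lemma new_pair_gt a : a < k < l -> i < l <= j ->
  (forall v w, a <= v < k -> k <= w < l -> r v w) ->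
  (forall v w, r v w -> ~~ ((v < k) && (k <= w < l)) -> i = v /\ j = w) ->
  i = k.-1 /\ j = l.
Proof.
move=> akl ij old new; have Ej : j = l.
  apply/eqP; rewrite eqn_leq andbC; case/andP: (ij) => _ -> /=; rewrite leqNgt.
  apply/negP => lj; have [h|h] := @r_cotrans i l j ltac:(lia) rij.
    by have := new _ _ h; lia.
  by have := new _ _ h; lia.
split=> //; case: (ltngtP i k.-1) => // ik.
  have [h|h] := @r_cotrans i k.-1 j ltac:(lia) rij; by have := new _ _ h; lia.
have h : r k.-1 i by apply: old; lia.
by have := new _ _ (r_trans h rij); lia.
Qed.

Lemma new_pair_lt b : k < l < b -> i < k <= j ->
  (forall v w, k <= v < l -> l <= w < b -> r v w) ->
  (forall v w, r v w -> ~~ ((k <= v < l) && (l <= w)) -> i = v /\ j = w) ->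
  i = k.-1 /\ j = l.
Proof.
move=> klb ij old new; have Ei : i = k.-1.
  apply/eqP; rewrite eqn_leq (_ : i <= k.-1) /=; last by lia.
  rewrite leqNgt; apply/negP => ik.
  by have [h|h] := @r_cotrans i k.-1 j ltac:(lia) rij; have := new _ _ h; lia.
split=> //; case: (ltngtP j l) => // jl.
  have h : r j l by apply: old; lia.
  by have := new _ _ (r_trans rij h); lia.
by have [h|h] := @r_cotrans i l j ltac:(lia) rij; have := new _ _ h; lia.
Qed.

End NewPair.

Section BetweenWeakAndBruhat.
Variables (alpha : seq nat) (prec : rel (multiperm alpha)).
Local Notation n := (sumn alpha).
Local Notation T := (multiperm alpha).
Local Notation cut k := (k \in Jcompl alpha).
Local Notation bot := (bot alpha).
Hypothesis po : partial_order prec.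
Hypothesis weak_prec : forall v w : T, weak_le (std v) (std w) -> prec v w.
Hypothesis prec_bruhat : forall v w : T, prec v w -> bruhat_le (std v) (std w).
Implicit Types x y z : T.

Lemma prec_inv x y : (forall i j, inv x i j -> inv y i j) -> prec x y.
Proof.
move=> h; apply: weak_prec; apply/forallP => i; apply/forallP => j; apply/implyP.
by rewrite -!posE => hij; have := h i j hij => /andP[].
Qed.

Lemma bot_prec x : prec bot x.
Proof. by apply: prec_inv => i j; rewrite inv_bot. Qed.

Lemma rk_le x y k q : prec x y -> rk x k q <= rk y k q.
Proof. by move=> h; rewrite !rkE; apply/bruhat_rank/prec_bruhat. Qed.

Lemma len_lt x y : prec x y -> x = y \/ len x < len y.
Proof.
move=> h; rewrite !lenE; have [/std_inj|] := bruhat_length (prec_bruhat h); by [left|right].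
Qed.

Lemma len_bot : len bot = 0.
Proof. by apply/eqP; rewrite cards_eq0; apply/eqP/setP => p; rewrite !inE inv_bot. Qed.

(** Take an inversion whose two positions are as close as possible: a letter placed between them
    would form a closer inversion with one of the two. *)
Lemma inv_adjacent y : y != bot -> exists i j, inv y i j /\ pos y i = (pos y j).+1.
Proof.
move=> ny; have [[i0 j0] h0] : exists p : 'I_n * 'I_n, inv y p.1 p.2.
  apply/existsP; apply: contraNT ny; rewrite negb_exists => /forallP h.
  apply/eqP/eq_inv => i j; rewrite inv_bot; apply/negbTE/negP => hij.
  have /andP[ij jn] := inv_lt hij; have := h (Ordinal (ltn_trans ij jn), Ordinal jn).
  by rewrite /= hij.
case: (@arg_minnP _ (i0, j0) (fun p => inv y p.1 p.2) (fun p => pos y p.1 - pos y p.2) h0).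
move=> [i j] /= hij hmin; exists i, j; split=> //.
have pji : pos y j < pos y i by case/andP: hij.
apply/eqP; rewrite eqn_leq pji andbT leqNgt; apply/negP => lt.
have cn : (pos y j).+1 < n by have := pos_lt y (ltn_ord i); lia.
pose c := std y (Ordinal cn).
have pc : pos y c = (pos y j).+1 by rewrite posE permK.
have ij : i < j by case/andP: hij.
case: (ltngtP c i) => hc; last 1 first.
- by move: lt; rewrite -pc hc ltnn.
- have /hmin /= : inv y (c, j).1 (c, j).2 by rewrite /inv /=; lia.
  by lia.
- have /hmin /= : inv y (i, c).1 (i, c).2 by rewrite /inv /=; lia.
  by lia.
Qed.

(** Exchanging two adjacent inverted letters removes this inversion only, so the result is smaller
    in the weak order. Inverted values that are consecutive are separated by a cut, so the exchange
    is allowed. *)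
Lemma len_pred y : y != bot -> exists2 x, prec x y & len y = (len x).+1.
Proof.
case/inv_adjacent=> i [j [hij pij]]; have /andP[ij jn] := inv_lt hij.
pose key (v : nat) := if v == i then pos y j else if v == j then pos y i else pos y v.
have [||x hx] := @key_multiperm alpha key.
- by move=> u v _ _; rewrite /key; repeat (case: ifP => ?); move/pos_inj; lia.
- move=> u un uc; have := pos_noncut y un uc.
  have : ~ (u = i /\ u.+1 = j).
    by case=> E1 E2; move: hij uc; rewrite -E1 -E2 => /inv_noncut ->.
  have pe v w : pos y v = pos y w -> v = w by apply: pos_inj.
  have := pe u.+1 i; have := pe u i; have := pe u.+1 j; have := pe u j.
  by rewrite /key; repeat (case: eqP => ?); subst; lia.
have hxy u v : inv x u v = inv y u v && ~~ ((u == i) && (v == j)).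
  case: (boolP (u < v < n)) => [huv|huv]; last first.
    transitivity false; first by apply: contraNF huv; apply: inv_lt.
    by apply/esym; apply: contraNF huv => /andP[/inv_lt].
  have pe v' w : pos y v' = pos y w -> v' = w by apply: pos_inj.
  have := pe v i; have := pe u i; have := pe v j; have := pe u j; have := pe u v.
  by rewrite hx // /key /inv; repeat (case: eqP => ?); subst; lia.
exists x; first by apply: prec_inv => u v; rewrite hxy => /andP[].
rewrite /len (cardsD1 (Ordinal (ltn_trans ij jn), Ordinal jn)) inE /= hij add1n.
congr _.+1; apply: eq_card => -[u v]; rewrite !inE /= hxy andbC.
by rewrite xpair_eqE -!val_eqE.
Qed.

Variables meet join : T -> T -> T.
Hypothesis lat : lattice_ops prec meet join.

Lemma len_join x y : len (join x y) + len (meet x y) = len x + len y.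
Proof. exact: (len_join_meet po lat len_lt len_bot bot_prec len_pred). Qed.

Lemma precxx x : prec x x. Proof. by case: po. Qed.

Lemma prec_trans y x z : prec x y -> prec y z -> prec x z.
Proof. by case: po => _ _; apply. Qed.

Lemma prec_len_eq x y : prec x y -> len y <= len x -> x = y.
Proof. exact: le_len_eq len_lt x y. Qed.

Lemma prec_len x y : prec x y -> len x <= len y.
Proof. exact: (le_len len_lt). Qed.

Lemma len0 x : len x = 0 -> x = bot.
Proof. by move=> h; apply/esym/prec_len_eq; rewrite ?bot_prec // h. Qed.

Lemma nocross_prec k x y : prec x y -> nocross k y -> nocross k x.
Proof.
case: (leqP k n) => kn.
  move=> h /(nocrossP y kn) E; apply/(nocrossP x kn).
  by have := rk_le k k h; rewrite E leqn0 => /eqP.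
by move=> _ _ i j hk; apply/negP => /inv_lt; lia.
Qed.

(** An inversion that leaves [a, b) crosses a place that no inversion of [y] crosses, and [nocross]
    passes to smaller elements. *)
Lemma inside_prec a b x y : prec x y -> inside a b y -> inside a b x.
Proof.
move=> xy hy i j hij; have := inv_lt hij => ijn; split; rewrite leqNgt; apply/negP => h.
  have /(nocross_prec xy)/(_ i j) : nocross i.+1 y.
    by move=> u v huv; apply/negP => /hy; lia.
  by rewrite hij; case/andP: ijn => -> _ /= /(_ _)/negP; apply; lia.
have /(nocross_prec xy)/(_ i j) : nocross j y.
  by move=> u v huv; apply/negP => /hy; lia.
by rewrite hij leqnn; case/andP: ijn => -> _ /(_ isT).
Qed.

Lemma nocross_atom k x : cut k -> nocross k x -> ~~ prec (atom alpha k) x.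
Proof.
move=> ck h; apply/negP => /nocross_prec/(_ h)/(_ k.-1 k); rewrite inv_atom // !eqxx.
have := cut_lt ck => hk; have -> : k.-1 < k <= k by lia.
by move/(_ isT).
Qed.

Lemma len_rect a k b : b <= n -> cut k -> a <= k <= b -> len (rect alpha a k b) = (k - a) * (b - k).
Proof.
move=> bn ck akb; have kn : k <= n by lia.
rewrite -(@card_ord_itv n a k kn) -(@card_ord_itv n k b bn).
rewrite -cardsX; apply: eq_card => -[i j]; rewrite !inE /= inv_rect //.
by rewrite !andbA.
Qed.

Lemma len_atom k : cut k -> len (atom alpha k) = 1.
Proof. by move=> ck; have := cut_lt ck => hk; rewrite len_rect //; nia. Qed.

Lemma atom_prec k x : cut k -> inv x k.-1 k -> prec (atom alpha k) x.
Proof.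
by move=> ck h; apply: prec_inv => i j; rewrite inv_atom // => /andP[/eqP-> /eqP->].
Qed.

Lemma exists_atom x : x != bot -> exists2 k, cut k & inv x k.-1 k.
Proof.
case/inv_adjacent=> i [j [hij _]].
have H u v : inv x u v -> exists k, inv x k k.+1.
  elim: v => [|v IH]; first by rewrite /inv.
  move=> h; have := inv_lt h; case: (ltngtP u v) => uv h2; last by exists v; rewrite -{1}uv.
    by have /orP[/IH//|h3] := @inv_cotrans _ x u v v.+1 ltac:(lia) h; exists v.
  by lia.
have [k hk] := H _ _ hij; exists k.+1 => //; exact: inv_noncut hk.
Qed.

Lemma prec_top a b x : b <= n -> inside a b x -> prec x (top alpha a b).
Proof. by move=> bn h; apply: prec_inv; apply: inv_le_top. Qed.

Lemma inside_top a b : b <= n -> inside a b (top alpha a b).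
Proof. by move=> bn; apply: inside_cutrev. Qed.

Lemma inside_join a b x y : b <= n -> inside a b x -> inside a b y -> inside a b (join x y).
Proof.
move=> bn hx hy; apply: inside_prec (inside_top bn).
by rewrite (join_le lat) !prec_top.
Qed.

Lemma pos_inside_lt a b z i : b <= n -> inside a b z -> i < a -> i < n -> pos z i <= i.
Proof.
move=> bn hz ia ni; rewrite -[X in _ <= X]addn0 -(subnn 0).
by apply: pos_le_add => // j /hz; lia.
Qed.

Lemma pos_inside_ge a b z j : b <= n -> inside a b z -> b <= j -> b <= pos z j.
Proof.
move=> bn hz bj; have := @pos_ge_add _ z j b b b bn; rewrite subnn addn0; apply=> [|i hi].
  by rewrite leqnn.
by rewrite pos_inv; [apply/negP => /hz|]; lia.
Qed.

Lemma rk_rect c m d : c <= m <= d -> d <= n -> cut m ->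
  d - m <= rk (rect alpha c m d) m (c + (d - m)).
Proof.
move=> cmd dn cm; rewrite -[X in X <= _](@card_ord_itv n m d dn).
apply/subset_leq_card/subsetP => j; rewrite !inE => /andP[mj jd]; rewrite mj /=.
suff : pos (rect alpha c m d) j <= c + (j - m) by lia.
apply: leq_trans (_ : #|[set i : 'I_n | 0 <= i < c] :|: [set i : 'I_n | m <= i < j]| <= _).
  apply: pos_le => // i; rewrite !inE /=; case: (ltngtP i j) => ij; last by rewrite ij ltnn.
    by rewrite pos_inv // inv_rect //; lia.
  by have := pos_inv (rect alpha c m d) ij; rewrite inv_rect //; lia.
by apply: leq_trans (leq_card_setU _ _) _; rewrite !card_ord_itv; lia.
Qed.

(** Between [rect c m d] and [z'], the inversions of [rect c m d] persist,
    although the Bruhat order alone does not preserve inversions. *)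
Lemma inv_rect_prec c m d z z' : c <= m <= d -> d <= n -> cut m ->
  prec (rect alpha c m d) z -> prec z z' ->
  (forall i, i < c -> pos z' i < c + (d - m)) ->
  (forall j, j < n -> d <= j -> c + (d - m) <= pos z' j) ->
  forall i j, inv (rect alpha c m d) i j -> inv z i j.
Proof.
move=> cmd dn cm hz zz' h1 h2 i j; rewrite inv_rect // => /and4P[ci im mj jd].
have cn : c <= n by lia.
have qn : c + (d - m) <= n by lia.
apply: (@inv_of_rk alpha z c m d); rewrite ?ci ?mj //.
- apply: lo_full => //; have := lo_rk z c qn; have := lo_rk z' c qn.
  have := rk_le c (c + (d - m)) zz'; have := lo_le z (c + (d - m)) cn.
  by rewrite (full_lo cn h1); lia.
- apply/rk0P; rewrite -leqn0; apply: leq_trans (rk_le _ _ zz') _.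
  by rewrite leqn0; apply/rk0P.
- by apply: leq_trans (rk_le _ _ hz); apply: rk_rect.
Qed.

Lemma inv_rect_inside a k b z : a <= k <= b -> b <= n -> cut k ->
  prec (rect alpha a k b) z -> inside a b z ->
  forall i j, inv (rect alpha a k b) i j -> inv z i j.
Proof.
move=> akb bn ck hz iz; apply: (inv_rect_prec akb bn ck hz (precxx z)) => [i ia|j jn bj].
  by apply: leq_ltn_trans (pos_inside_lt bn iz ia _) _; lia.
by apply: leq_trans (pos_inside_ge bn iz bj); lia.
Qed.

Lemma rect_prec_cutrev a k b (S : seq nat) : b <= n -> {subset S <= Jcompl alpha} ->
  k \in S -> prec (rect alpha a k b) (cutrev alpha a b S).
Proof.
move=> bn hS kS; apply: prec_inv => i j; rewrite inv_rect ?hS // inv_cutrev //.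
by case/and4P=> -> ik kj ->; apply/hasP; exists k => //; rewrite ik.
Qed.

(** The join is at most the right-hand side by the weak order. Being supported in [a, b), it inverts
    the pairs of every rectangle below it, so it is not shorter. *)
Lemma cutrev_join a b (S S' : seq nat) : b <= n ->
  {subset S <= Jcompl alpha} -> {subset S' <= Jcompl alpha} ->
  (forall k, k \in S ++ S' -> a <= k <= b) ->
  join (cutrev alpha a b S) (cutrev alpha a b S') = cutrev alpha a b (S ++ S').
Proof.
move=> bn hS hS' hab; have hSS : {subset S ++ S' <= Jcompl alpha}.
  by move=> k; rewrite mem_cat => /orP[/hS|/hS'].
have le1 : prec (cutrev alpha a b S) (cutrev alpha a b (S ++ S')).
  by apply: prec_inv => i j; rewrite !inv_cutrev // has_cat => /and3P[-> -> ->].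
have le2 : prec (cutrev alpha a b S') (cutrev alpha a b (S ++ S')).
  by apply: prec_inv => i j; rewrite !inv_cutrev // has_cat orbC => /and3P[-> -> ->].
apply: prec_len_eq; first by rewrite (join_le lat) le1.
apply/prec_len/prec_inv => i j; rewrite inv_cutrev // => /and3P[ai jb /hasP[k kS ijk]].
have ck := hSS k kS.
apply: (@inv_rect_inside a k b); rewrite ?hab //.
- move: kS; rewrite mem_cat => /orP[] kS.
    exact: prec_trans (rect_prec_cutrev _ _ _ kS) (le_joinl po lat _ _).
  exact: prec_trans (rect_prec_cutrev _ _ _ kS) (le_joinr po lat _ _).
- by apply: inside_join => //; apply: inside_cutrev.
- by rewrite inv_rect //; lia.
Qed.

(** The inversions of the join form a union, so the length identity leaves the size of the
    intersection for the meet. *)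
Lemma len_meet_cutrev a b (S S' : seq nat) : b <= n ->
  {subset S <= Jcompl alpha} -> {subset S' <= Jcompl alpha} ->
  (forall k, k \in S ++ S' -> a <= k <= b) ->
  len (meet (cutrev alpha a b S) (cutrev alpha a b S'))
  = #|[set p : 'I_n * 'I_n | inv (cutrev alpha a b S) p.1 p.2 && inv (cutrev alpha a b S') p.1 p.2]|.
Proof.
move=> bn hS hS' hab; have := len_join (cutrev alpha a b S) (cutrev alpha a b S').
have hSS : {subset S ++ S' <= Jcompl alpha}.
  by move=> k; rewrite mem_cat => /orP[/hS|/hS'].
rewrite cutrev_join // => E.
apply/eqP; rewrite -(eqn_add2l (len (cutrev alpha a b (S ++ S')))) E /len -cardsUI.
apply/eqP; congr (_ + _); apply: eq_card => p; rewrite !inE //.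
by rewrite !inv_cutrev // has_cat; case: (_ <= _); case: (_ < b).
Qed.

(** * Atoms and the choice of a root *)

Lemma atom_meet k x : cut k -> ~~ prec (atom alpha k) x -> meet (atom alpha k) x = bot.
Proof.
move=> ck h; apply: len0; apply/eqP; rewrite -leqn0 leqNgt; apply/negP => h0.
have E : meet (atom alpha k) x = atom alpha k.
  by apply: prec_len_eq; rewrite ?(meet_lel po lat) ?len_atom.
by case/negP: h; rewrite -E (meet_ler po lat).
Qed.

Lemma atom_join k x y : cut k -> prec (atom alpha k) (join x y) ->
  prec (atom alpha k) x || prec (atom alpha k) y.
Proof.
move=> ck h; apply/negPn/negP; rewrite negb_or => /andP[hx hy].
have := meet_idl po lat h; rewrite (meet_joinr lat) !atom_meet //.
rewrite (join_bot po lat bot_prec) => E; have := len_atom ck.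
by rewrite -E len_bot.
Qed.

Lemma len_join_atom k x : cut k -> ~~ prec (atom alpha k) x ->
  len (join x (atom alpha k)) = (len x).+1.
Proof.
move=> ck h; have := len_join x (atom alpha k).
by rewrite (meetC po lat) atom_meet // len_bot addn0 len_atom // addn1.
Qed.

(** Since [z] covers [u], it is the join of [u] and [g]; as [atom l] is prime, it lies below one of
    them. *)
Lemma atom_cover l (u g z : T) : cut l -> prec u z -> len z = (len u).+1 ->
  prec (atom alpha l) z -> ~~ prec (atom alpha l) u ->
  prec g z -> ~~ prec g u -> prec (atom alpha l) g.
Proof.
move=> cl uz E lz lu gz gu; have jz : prec (join u g) z by rewrite (join_le lat) uz.
have Ez : join u g = z.
  apply: prec_len_eq => //; rewrite E.
  case: (len_lt (le_joinl po lat u g)) => // Eu; case/negP: gu; rewrite Eu.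
  exact: (le_joinr po lat).
by move: lz; rewrite -Ez => /(atom_join cl); rewrite (negbTE lu).
Qed.

Lemma inv_new (u z : T) i j i' j' : (forall v w, inv u v w -> inv z v w) -> len z = (len u).+1 ->
  inv z i j -> ~~ inv u i j -> inv z i' j' -> ~~ inv u i' j' -> i = i' /\ j = j'.
Proof.
move=> uz E h nh h' nh'; have /andP[ij jn] := inv_lt h; have /andP[ij' jn'] := inv_lt h'.
pose p := (Ordinal (ltn_trans ij jn), Ordinal jn).
pose p' := (Ordinal (ltn_trans ij' jn'), Ordinal jn').
set A := [set q : 'I_n * 'I_n | inv u q.1 q.2]; set B := [set q : 'I_n * 'I_n | inv z q.1 q.2].
have AB : A \subset B by apply/subsetP => q; rewrite !inE; apply: uz.
have /eqP/cards1P[q Eq] : #|B :\: A| = 1.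
  by rewrite cardsD (setIidPr AB); move: E; rewrite /len -/A -/B; lia.
have /set1P Ep : p \in [set q] by rewrite -Eq !inE /= h nh.
have /set1P Ep' : p' \in [set q] by rewrite -Eq !inE /= h' nh'.
by have := etrans Ep (esym Ep') => -[].
Qed.

(** The join [z] of [rect a k l] with [atom l] covers it, so it has a single new
    inversion, which can only be [(k.-1, l)]; now use that [atom l] is prime. *)
Lemma atom_rect_gt a k l b : a < k < l -> l < b <= n -> cut k -> cut l ->
  prec (atom alpha l) (rect alpha a k b) ->
  prec (atom alpha l) (rect alpha k.-1 k l.+1).
Proof.
move=> akl lb ck cl h; have ln : l <= n by lia.
have ln' : l < n by lia.
have bn : b <= n by lia.
pose u := rect alpha a k l; pose z := join u (atom alpha l).
have ncu : nocross l u by move=> i j ij; rewrite inv_rect //; lia.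
have lu : ~~ prec (atom alpha l) u by apply: nocross_atom.
have lz : prec (atom alpha l) z by apply: (le_joinr po lat).
have uz : prec u z by apply: (le_joinl po lat).
have Ez : len z = (len u).+1 by apply: len_join_atom.
have zb : prec z (rect alpha a k b).
  by rewrite (join_le lat) h andbT; apply: prec_inv => i j; rewrite !inv_rect //; lia.
(* That [u] is below [z] does not by itself preserve inversions; the upper bound [zb] confines the
   positions enough for that. *)
have iuz i j : inv u i j -> inv z i j.
  apply: (inv_rect_prec _ _ _ uz zb) => // [|i' ia|j' jn lj]; first by lia.
    by apply: leq_ltn_trans (pos_inside_lt bn (inside_rect bn ck) ia _) _; lia.
  apply: pos_ge_add; rewrite ?ln //; first by lia.
  by move=> i' hi; rewrite pos_inv ?inv_rect //; lia.
have hz : inv z k.-1 l.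
  apply/negPn/negP => nz; suff /(nocross_atom cl) : nocross l z by rewrite lz.
  move=> i j ij; apply/negP => hij.
  suff [Ei Ej] : i = k.-1 /\ j = l by rewrite -Ei -Ej hij in nz.
  apply: (@new_pair_gt (inv z) _ _ _ _ _ _ hij a) => // [u' v w|u' v w hu hw|v w h1 h2|v w hvw nvw].
  - exact: inv_trans.
  - by apply/orP; apply: inv_cotrans.
  - by apply: iuz; rewrite inv_rect // andbA h1.
  - apply: (inv_new iuz Ez hij _ hvw); rewrite inv_rect //.
      by case/andP: ij => _ lj; rewrite [j < l]ltnNge lj !andbF.
    by apply: contra nvw => /and4P[_ -> -> ->].
apply: (atom_cover cl uz Ez lz lu).
  apply: prec_inv => i j; rewrite inv_rect // => /and4P[h1 h2 h3 h4].
  have -> : i = k.-1 by lia.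
  case: (ltngtP j l) => jl; [|lia|by rewrite jl].
  by apply: iuz; rewrite inv_rect //; lia.
apply/negP => /nocross_prec/(_ ncu)/(_ k.-1 l); rewrite inv_rect //; lia.
Qed.

(** The mirror image of [atom_rect_gt]: here the cover is that of [rect k l b] by its join with
    [atom k]. *)
Lemma atom_rect_lt a k l b : a < k < l -> l < b <= n -> cut k -> cut l ->
  prec (atom alpha k) (rect alpha a l b) ->
  prec (atom alpha k) (rect alpha k.-1 l l.+1).
Proof.
move=> akl lb ck cl h; have ln : l < n by lia.
have bn : b <= n by lia.
pose u := rect alpha k l b; pose z := join u (atom alpha k).
have ncu : nocross k u by move=> i j ij; rewrite inv_rect //; lia.
have lu : ~~ prec (atom alpha k) u by apply: nocross_atom.
have lz : prec (atom alpha k) z by apply: (le_joinr po lat).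
have uz : prec u z by apply: (le_joinl po lat).
have Ez : len z = (len u).+1 by apply: len_join_atom.
have zb : prec z (rect alpha a l b).
  by rewrite (join_le lat) h andbT; apply: prec_inv => i j; rewrite !inv_rect //; lia.
have iuz i j : inv u i j -> inv z i j.
  apply: (inv_rect_prec _ _ _ uz zb) => // [|i' ia|j' jn lj]; first by lia.
    apply: leq_ltn_trans (_ : i' + (b - l) < _); last by lia.
    by apply: pos_le_add; rewrite ?bn //; [move=> j'; rewrite inv_rect //; lia|lia].
  by apply: leq_trans (pos_inside_ge bn (inside_rect bn cl) lj); lia.
have hz : inv z k.-1 l.
  apply/negPn/negP => nz; suff /(nocross_atom ck) : nocross k z by rewrite lz.
  move=> i j ij; apply/negP => hij.
  suff [Ei Ej] : i = k.-1 /\ j = l by rewrite -Ei -Ej hij in nz.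
  apply: (@new_pair_lt (inv z) _ _ _ _ _ _ hij b) => // [u' v w|u' v w hu hw||v w h1 h2|v w hvw nvw].
  - exact: inv_trans.
  - by apply/orP; apply: inv_cotrans.
  - by lia.
  - by apply: iuz; rewrite inv_rect // andbA h1.
  - apply: (inv_new iuz Ez hij _ hvw); rewrite inv_rect //.
      by case/andP: ij => ik _; rewrite [k <= i]leqNgt ik.
    by apply: contra nvw => /and4P[-> -> -> _].
apply: (atom_cover ck uz Ez lz lu).
  apply: prec_inv => i j; rewrite inv_rect // => /and4P[h1 h2 h3 h4].
  have -> : j = l by lia.
  case: (ltngtP i k.-1) => ik; [lia| |by rewrite ik].
  by apply: iuz; rewrite inv_rect //; lia.
apply/negP => /nocross_prec/(_ ncu)/(_ k.-1 l); rewrite inv_rect //; lia.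
Qed.

Lemma rect_seq1 k : cut k -> {subset [:: k] <= Jcompl alpha}.
Proof. by move=> ck l; rewrite inE => /eqP->. Qed.

Lemma len_meet_rect a k l b : a <= k <= l -> l <= b <= n -> cut k -> cut l ->
  len (meet (rect alpha a k b) (rect alpha a l b)) = (k - a) * (b - l).
Proof.
move=> akl lbn ck cl; have bn : b <= n by lia.
have kn : k <= n by lia.
rewrite /rect len_meet_cutrev //; [|exact: rect_seq1|exact: rect_seq1|].
  rewrite -(@card_ord_itv n a k kn) -(@card_ord_itv n l b bn) -cardsX.
  by apply: eq_card => -[i j]; rewrite !inE /= !inv_rect //; lia.
by move=> m; rewrite !inE => /orP[] /eqP->; lia.
Qed.

(** If both held, then the two atoms would lie below the meet of the two
    rectangles of the interval [k.-1, l.+1), which has length 1. *)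
Lemma atom_rect_asym a k l b : a < k < l -> l < b <= n -> cut k -> cut l ->
  prec (atom alpha l) (rect alpha a k b) -> ~~ prec (atom alpha k) (rect alpha a l b).
Proof.
move=> akl lbn ck cl hl; apply/negP => hk.
have kl : prec (atom alpha k) (rect alpha k.-1 k l.+1).
  by apply: atom_prec; rewrite // inv_rect //; lia.
have ll : prec (atom alpha l) (rect alpha k.-1 l l.+1).
  by apply: atom_prec; rewrite // inv_rect //; lia.
set m := meet (rect alpha k.-1 k l.+1) (rect alpha k.-1 l l.+1).
have lm : len m = 1 by rewrite len_meet_rect //; nia.
have E c : cut c -> prec (atom alpha c) m -> atom alpha c = m.
  by move=> cc h; apply: prec_len_eq; rewrite ?lm ?len_atom.
have Ek : atom alpha k = m.
  by apply: E => //; rewrite (le_meet lat) kl; apply: atom_rect_lt hk => //; lia.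
have El : atom alpha l = m.
  by apply: E => //; rewrite (le_meet lat) ll andbT; apply: atom_rect_gt hl => //; lia.
have := inv_atom k.-1 k ck; rewrite Ek -El inv_atom // !eqxx; lia.
Qed.

(** By distributivity, the join of [rect a l b] with the meet is the meet of two cut reversals. A
    pair separated by both sets of cuts is separated by [l], which lies between [k] and [m], so the
    join is no longer than [rect a l b]. *)
Lemma meet_rect_prec a k l m b : a <= k <= l -> l <= m <= b -> b <= n ->
  cut k -> cut l -> cut m ->
  prec (meet (rect alpha a k b) (rect alpha a m b)) (rect alpha a l b).
Proof.
move=> akl lmb bn ck cl cm; set y := meet _ _.
have hs2 u v : cut u -> cut v -> {subset [:: u; v] <= Jcompl alpha}.
  by move=> cu cv w; rewrite !inE => /orP[] /eqP->.
have E : join (rect alpha a l b) y = meet (cutrev alpha a b [:: l; k]) (cutrev alpha a b [:: l; m]).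
  rewrite /y (join_meetr po lat) !cutrev_join //; try exact: rect_seq1.
    by move=> w; rewrite !inE => /orP[] /eqP->; lia.
  by move=> w; rewrite !inE => /orP[] /eqP->; lia.
suff <- : join (rect alpha a l b) y = rect alpha a l b by apply: (le_joinr po lat).
apply/esym/prec_len_eq; first exact: (le_joinl po lat).
rewrite E len_meet_cutrev //; try exact: hs2; last first.
  by move=> w; rewrite !inE => /or4P[] /eqP->; lia.
apply/subset_leq_card/subsetP => -[i j]; rewrite !inE /= inv_rect // !inv_cutrev //=; try exact: hs2.
lia.
Qed.

(** The meet of all the [rect a l b] is nontrivial, and the root is given by any
    atom below it. *)
Lemma exists_root a b : b <= n -> (exists2 k, cut k & a < k < b) ->
  exists k, [/\ cut k, a < k < b
    & forall l, cut l -> a < l < b -> l != k -> ~~ prec (atom alpha l) (rect alpha a k b)].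
Proof.
move=> bn [k0 ck0 hk0].
have ex : exists k, cut k && (a < k < b) by exists k0; rewrite ck0.
have ub k : cut k && (a < k < b) -> k <= n by move=> /andP[_]; lia.
case: (ex_minnP ex) => f /andP[cf hf] fmin.
case: (ex_maxnP ex ub) => g /andP[cg hg] gmax.
(* By [meet_rect_prec], the meet for the two extreme cuts [f] and [g] is already below the rectangle
   of every cut between them. *)
set y := meet (rect alpha a f b) (rect alpha a g b).
have ny : y != bot.
  have fg : f <= g by apply: fmin; rewrite cg.
  apply/eqP => E; have : len y = (f - a) * (b - g) by rewrite len_meet_rect //; lia.
  by rewrite E len_bot; nia.
have iy : inside a b y.
  by apply: inside_prec (inside_rect bn cf); apply: (meet_lel po lat).
have [k ck hk] := exists_atom ny; have [ak kb] := iy _ _ hk; exists k.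
have hkab : a < k < b by have := cut_lt ck; lia.
have yl l : cut l -> a < l < b -> prec (atom alpha k) (rect alpha a l b).
  move=> cl hl; apply: prec_trans (atom_prec ck hk) _.
  have fl : f <= l by apply: fmin; rewrite cl.
  have lg : l <= g by apply: gmax; rewrite cl.
  by apply: meet_rect_prec => //; lia.
split=> // l cl hl lk; apply/negP => h.
case: (ltngtP k l) => kl; last by rewrite kl eqxx in lk.
  have := @atom_rect_asym a k l b ltac:(lia) ltac:(lia) ck cl h.
  by rewrite yl.
by have := @atom_rect_asym a l k b ltac:(lia) ltac:(lia) cl ck (yl l cl hl); rewrite h.
Qed.

Lemma bot_of_le_atoms x : (forall k, cut k -> inv x k.-1 k -> False) -> x = bot.
Proof. by move=> h; apply/eqP/negPn/negP => /exists_atom[k ck]; apply: h. Qed.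

Lemma join_botl x : join bot x = x.
Proof. exact: (join_idr po lat (bot_prec x)). Qed.

Lemma meet_inside_bot a k b x y : inside a k x -> inside k b y -> meet x y = bot.
Proof.
move=> hx hy; apply: bot_of_le_atoms => l cl hl; have := cut_lt cl.
have := inside_prec (meet_lel po lat x y) hx hl.
by have := inside_prec (meet_ler po lat x y) hy hl; lia.
Qed.

Lemma prec_res x a b : prec (res x a b) x.
Proof. by apply: prec_inv => i j; rewrite inv_res => /and3P[]. Qed.

(** * Decomposition of an interval at its root *)

Section Root.
Variables a k b : nat.
Hypotheses (bn : b <= n) (ck : cut k) (akb : a < k < b).
Hypothesis root : forall l, cut l -> a < l < b -> l != k ->
  ~~ prec (atom alpha l) (rect alpha a k b).
Local Notation m := (rect alpha a k b).
Local Notation lower := (top alpha a k).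
Local Notation upper := (top alpha k b).

Let kn : k <= n. Proof. lia. Qed.

(** A nontrivial meet would be above an atom at some cut in the open interval from [a] to [k], which
    [root] forbids. *)
Lemma root_meet_lower x : inside a k x -> meet m x = bot.
Proof.
move=> hx; apply: bot_of_le_atoms => l cl hl; have := cut_lt cl.
have := inside_prec (meet_ler po lat m x) hx hl => h1 h2.
have := root cl ltac:(lia) ltac:(lia); apply/negP/negPn.
exact: prec_trans (atom_prec cl hl) (meet_lel po lat _ _).
Qed.

Lemma root_meet_upper x : inside k b x -> meet m x = bot.
Proof.
move=> hx; apply: bot_of_le_atoms => l cl hl; have := cut_lt cl.
have := inside_prec (meet_ler po lat m x) hx hl => h1 h2.
have := root cl ltac:(lia) ltac:(lia); apply/negP/negPn.
exact: prec_trans (atom_prec cl hl) (meet_lel po lat _ _).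
Qed.

Lemma len_root_join h x y : prec h m -> inside a k x -> inside k b y ->
  len (join h (join x y)) = len h + len x + len y.
Proof.
move=> hm hx hy.
have hbot z : meet m z = bot -> meet h z = bot.
  move=> E; apply: len0; apply/eqP; rewrite -leqn0 -len_bot -E; apply: prec_len.
  by rewrite (le_meet lat) (meet_ler po lat) (prec_trans (meet_lel po lat _ _)).
have := len_join h (join x y); have := len_join x y.
rewrite (meet_inside_bot hx hy) (meet_joinr lat).
rewrite (hbot x (root_meet_lower hx)) (hbot y (root_meet_upper hy)).
by rewrite join_botl len_bot; lia.
Qed.

Lemma len_le_split (x u v w : T) :
  (forall i j, inv x i j -> [|| inv u i j, inv v i j | inv w i j]) ->
  len x <= len u + len v + len w.
Proof.
move=> h; rewrite /len.
set A := [set p | inv u _ _]; set B := [set p | inv v _ _]; set C := [set p | inv w _ _].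
apply: leq_trans (_ : #|A :|: B :|: C| <= _).
  by apply/subset_leq_card/subsetP => p; rewrite !inE -orbA; apply: h.
by apply: leq_trans (leq_card_setU _ _) _; rewrite leq_add2r leq_card_setU.
Qed.

(** The join is below by the weak order, and by additivity of lengths it has room for all the
    inversions of [separate]. *)
Lemma root_separateE x : inside a b x ->
  separate x a k b = join m (join (res x a k) (res x k b)).
Proof.
move=> hx; apply/esym/prec_len_eq; last first.
  rewrite len_root_join ?precxx //; try exact: inside_res.
  by apply: len_le_split => i j; rewrite inv_separate.
rewrite !(join_le lat); apply/and3P; split; apply: prec_inv => i j h;
  by rewrite inv_separate // h ?orbT.
Qed.

Lemma root_topE : top alpha a b = join m (join lower upper).
Proof.
apply/esym/prec_len_eq; last first.
  rewrite len_root_join ?precxx //; try exact: inside_top.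
  apply: len_le_split => i j.
  rewrite (inv_top a i j bn) (inv_top a i j kn) (inv_top k i j bn) (inv_rect a i j bn ck).
  case/and3P=> ai jb hc; rewrite ai jb hc !andbT /=; have := hc.
  by case/hasP=> l _; lia.
rewrite !(join_le lat); apply/and3P; split; apply: prec_inv => i j.
- rewrite (inv_rect a i j bn ck) (inv_top a i j bn) => /and4P[-> ik kj ->]; apply/hasP; exists k => //.
  by rewrite ik.
- by rewrite (inv_top a i j kn) (inv_top a i j bn) => /and3P[-> jk ->]; lia.
- by rewrite (inv_top k i j bn) (inv_top a i j bn) => /and3P[ki -> ->]; lia.
Qed.

Lemma prec_separate x : inside a b x -> prec x (separate x a k b).
Proof.
move=> hx; apply: prec_inv => i j hij; rewrite inv_separate // inv_rect // !inv_res hij.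
by have := hx _ _ hij; rewrite !andbT; lia.
Qed.

(** In the decomposition of [separate x a k b], which is above [x], only the component supported in
    [a, k) has a nontrivial meet with [lower]. *)
Lemma meet_lower x : inside a b x -> meet x lower = res x a k.
Proof.
move=> hx; have ires := @inside_res alpha x.
case: po => _ anti _; apply: anti; apply/andP; split; last first.
  by rewrite (le_meet lat) prec_res (prec_top kn (ires a k)).
apply: (@prec_trans (meet lower (separate x a k b))).
  by rewrite (le_meet lat) (meet_ler po lat) (prec_trans (meet_lel po lat _ _) (prec_separate hx)).
rewrite root_separateE // !(meet_joinr lat) (meetC po lat _ m) root_meet_lower; last exact: inside_top.
rewrite (meet_inside_bot (inside_top kn) (ires k b)) join_botl (join_bot po lat bot_prec).
exact: (meet_ler po lat).
Qed.

Lemma meet_upper x : inside a b x -> meet x upper = res x k b.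
Proof.
move=> hx; have ires := @inside_res alpha x.
case: po => _ anti _; apply: anti; apply/andP; split; last first.
  by rewrite (le_meet lat) prec_res (prec_top bn (ires k b)).
apply: (@prec_trans (meet upper (separate x a k b))).
  by rewrite (le_meet lat) (meet_ler po lat) (prec_trans (meet_lel po lat _ _) (prec_separate hx)).
rewrite root_separateE // !(meet_joinr lat) (meetC po lat _ m) root_meet_upper; last exact: inside_top.
rewrite (meetC po lat upper) (meet_inside_bot (ires a k) (inside_top bn)) !join_botl.
exact: (meet_ler po lat).
Qed.

Lemma root_decomp x : inside a b x ->
  x = join (meet x m) (join (res x a k) (res x k b)).
Proof.
move=> hx; rewrite -meet_lower // -meet_upper // -!(meet_joinr lat) -root_topE.
by rewrite (meet_idl po lat) // prec_top.
Qed.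

(** The restrictions of [meet x m] to the two sides of [k] are below [m] and supported on one side,
    hence trivial. *)
Lemma root_meet_cross x i j : inside a b x -> inv (meet x m) i j -> i < k <= j.
Proof.
move=> hx hij; have [ai jb] := inside_prec (meet_lel po lat x m) hx hij.
have hm : prec (meet x m) m by apply: (meet_ler po lat).
have E c d : meet m (res (meet x m) c d) = bot -> res (meet x m) c d = bot.
  by rewrite (meetC po lat) (meet_idl po lat) // (prec_trans (prec_res _ _ _) hm).
have E1 : res (meet x m) a k = bot by apply/E/root_meet_lower/inside_res.
have E2 : res (meet x m) k b = bot by apply/E/root_meet_upper/inside_res.
have := inv_res (meet x m) a k i j; have := inv_res (meet x m) k b i j.
by rewrite E1 E2 !inv_bot hij ai jb; lia.
Qed.

(** The Bruhat order gives [<=], and the two sides have the same sum over [q]. *)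
Lemma root_meet_rk x q : inside a b x -> q <= n -> rk (meet x m) k q = rk x k q.
Proof.
move=> hx; have hm : prec (meet x m) m by apply: (meet_ler po lat).
apply: rk_eq => [r|]; first by apply/rk_le/(meet_lel po lat).
(* The two restrictions account for the inversions of [x] on either side of [k], so the length left
   for [meet x m] is at least the number of crossings of [x]. *)
have := congr1 (@len alpha) (root_decomp hx).
rewrite len_root_join //; try exact: inside_res.
have -> : crossings k (meet x m) = len (meet x m).
  apply: eq_card => p; rewrite !inE; case: (boolP (inv _ _ _)); rewrite ?andbF //.
  by move/(root_meet_cross hx) ->.
suff : crossings k x + (len (res x a k) + len (res x k b)) <= len x by lia.
have -> : len (res x a k) + len (res x k b) =
    #|[set p : 'I_n * 'I_n | inv (res x a k) p.1 p.2 || inv (res x k b) p.1 p.2]|.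
  rewrite /len -cardsUI -[RHS]addn0; congr (_ + _).
    by apply: eq_card => p; rewrite !inE.
  apply/eqP; rewrite cards_eq0; apply/eqP/setP => p; rewrite !inE !inv_res.
  by apply/negbTE/negP => /andP[/and3P[_ h1 /inv_lt h2] /and3P[h3 _ _]]; lia.
rewrite /crossings -cardsUI [X in _ + X](_ : _ = 0) ?addn0.
  apply/subset_leq_card/subsetP => p; rewrite !inE !inv_res.
  by case: (inv x _ _); rewrite ?andbF.
apply/eqP; rewrite cards_eq0; apply/eqP/setP => p; rewrite !inE !inv_res.
apply/negbTE/negP => /andP[/andP[h1 /inv_lt h2]].
by case/orP=> /and3P[h3 h4 _]; lia.
Qed.

(** Restrictions are monotone because they are meets with fixed elements. Conversely the components
    of [x] are compared one by one, the crossing ones as shuffles of two sorted words. *)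
Lemma root_prec x y : inside a b x -> inside a b y ->
  prec x y <-> [/\ forall q, q <= n -> rk x k q <= rk y k q,
    prec (res x a k) (res y a k) & prec (res x k b) (res y k b)].
Proof.
move=> hx hy; split=> [xy|[hr h1 h2]].
  split=> [q _||]; first exact: rk_le.
    rewrite -!meet_lower // (le_meet lat) (meet_ler po lat).
    by rewrite (prec_trans (meet_lel po lat _ _) xy).
  rewrite -!meet_upper // (le_meet lat) (meet_ler po lat).
  by rewrite (prec_trans (meet_lel po lat _ _) xy).
rewrite (root_decomp hx) !(join_le lat); apply/and3P; split.
- apply: prec_trans (meet_lel po lat y m); apply: prec_inv.
  apply: (@inv_of_rk_le alpha k) => [i j|i j|q qn]; try exact: root_meet_cross.
  by rewrite !root_meet_rk // hr.
- exact: prec_trans h1 (prec_res _ _ _).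
- exact: prec_trans h2 (prec_res _ _ _).
Qed.

End Root.

(** * Recursion over the intervals *)

Definition shape_le x y a k b :=
  forall i j, i < k - a -> j < b - k -> shape x a k b i j -> shape y a k b i j.

(** By induction on the length of the interval; [s] lists the root, then the labels on its left and
    on its right, so it is a preorder of the tree being built. *)
Lemma res_prec_shapes a b : b <= n -> exists s,
  [/\ uniq s, forall k, (k \in s) = cut k && (a < k < b)
    & forall x y, prec (res x a b) (res y a b) <->
        forall k a' b', k \in s -> subtree_bounds s a b k a' b' -> shape_le x y a' k b'].
Proof.
have [d] := ubnP (b - a); elim: d a b => // d IH a b hd bn.
case: (boolP (has (fun k => a < k < b) (Jcompl alpha))) => [/hasP[k0 ck0 hk0]|nocut]; last first.
  exists [::]; split=> // [k|x y].
    by apply/esym/negbTE; apply: contra nocut => /andP[ck hk]; apply/hasP; exists k.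
  split=> // _; apply: prec_inv => i j; rewrite inv_res => /and3P[ai jb /inv_cut[k ck hk]].
  by case/negP: nocut; apply/hasP; exists k => //; lia.
have [r [cr hr root]] := exists_root bn (ex_intro2 _ _ k0 ck0 hk0).
have rn : r <= n by lia.
have [s1 [u1 m1 H1]] := IH a r ltac:(lia) rn.
have [s2 [u2 m2 H2]] := IH r b ltac:(lia) bn.
have h1 l : l \in s1 -> a < l < r by rewrite m1 => /andP[].
have h2 l : l \in s2 -> r < l < b by rewrite m2 => /andP[].
exists (r :: s1 ++ s2); split.
- rewrite /= mem_cat negb_or cat_uniq u1 u2 !andbT /=; apply/andP; split.
  + by rewrite m1 m2; lia.
  + by apply/hasPn => l /h2 hl; apply/negP => /h1; lia.
- move=> k; rewrite inE mem_cat m1 m2; case: (eqVneq k r) => [->|kr]; first by rewrite cr.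
  by case: (cut k) => //=; lia.
move=> x y; have ix := @inside_res alpha x a b; have iy := @inside_res alpha y a b.
have ar : a <= r by lia.
have rb : r <= b by lia.
have := root_prec bn cr hr root ix iy.
rewrite (res_res x (leqnn a) rb) (res_res y (leqnn a) rb).
rewrite (res_res x ar (leqnn b)) (res_res y ar (leqnn b)) => P.
have Esh : (forall q, q <= n -> rk (res x a b) r q <= rk (res y a b) r q) <-> shape_le x y a r b.
  rewrite (rk_shape hr bn ix iy); split=> h i j hi hj.
    by move/(shape_res hr bn x hi hj)/(h i j hi hj)/(shape_res hr bn y hi hj).
  by move/(shape_res hr bn x hi hj)/(h i j hi hj)/(shape_res hr bn y hi hj).
split=> [/P[/Esh e0 /H1 e1 /H2 e2] k a' b'|h].
  rewrite inE mem_cat => /or3P[/eqP->|ks|ks].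
  - by move/(subtree_bounds_root s1 s2 hr) => [-> ->].
  - by move/(subtree_bounds_left s2 hr h1 a' b' ks)/e1; apply.
  - by move/(subtree_bounds_right hr h1 h2 a' b' ks)/e2; apply.
apply/P; split; [apply/Esh|apply/H1|apply/H2].
- apply: h; first exact: mem_head.
  by apply/(subtree_bounds_root s1 s2 hr).
- move=> k a' b' ks hb; apply: h; first by rewrite inE mem_cat ks orbT.
  exact/(subtree_bounds_left s2 hr h1 a' b' ks).
- move=> k a' b' ks hb; apply: h; first by rewrite inE mem_cat ks !orbT.
  exact/(subtree_bounds_right hr h1 h2 a' b' ks).
Qed.

End BetweenWeakAndBruhat.

(** * Identification with the order of a binary search tree *)

Lemma mem_IU (alpha s : seq nat) (v : multiperm alpha) i j :
  perm_eq s (Jcompl alpha) ->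
  (i, j) \in IU (bst s) v <-> exists k a b,
    [/\ k \in s, subtree_bounds s 0 (sumn alpha) k a b, a < i <= k, k < j <= b
      & shape v a k b (i - a.+1) (j - k.+1)].
Proof.
move=> ps; have us : uniq s by rewrite (perm_uniq ps) filter_uniq ?iota_uniq.
have sn : {in s, forall l, 0 < l < sumn alpha}.
  by move=> l; rewrite (perm_mem ps) => /cut_lt.
rewrite /IU /completion Itree_Palpha // mem_filter [X in _ && X]mem_filter [X in _ && (_ && X)]mem_Pn.
rewrite (perm_has _ (perm_preorder_bst us)); split.
  case/and3P=> _ /hasP[k ks]; have [] := Rtree_maxP us ks (sn k ks).
  case E: (Rtree_max _ _ _) => [A B].
  rewrite mem_filter mem_Pn /= => /andP[_ /andP[A0 _]] _ /and3P[h1 h2 h3] _.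
  have Ap : A.-1.+1 = A by lia.
  exists k, A.-1, B; rewrite /shape Ap; split=> //.
  by apply/(Rtree_max_bounds _ _ us sn ks); rewrite E Ap.
case=> k [a [b [ks hb h1 h2 h3]]]; have hk := sn k ks.
have bn : b <= sumn alpha by case: hb => _ [->|/mem_take/sn] //; lia.
rewrite mem_filter mem_Pn /=; apply/and3P; split; [apply/andP; split| |lia].
(* The pair is in [Palpha] because the label [k] is itself a cut between its coordinates. *)
- by apply/hasP; exists k; rewrite -?(perm_mem ps) //; lia.
- by lia.
- apply/hasP; exists k => //; have /(Rtree_max_bounds _ _ us sn ks) -> := hb.
  by rewrite h1 h2.
Qed.

Theorem theorem6p3 (alpha : seq nat) (Halpha : is_composition alpha)
    (prec : rel (multiperm alpha))
    (Hpo : partial_order prec)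
    (Hdl : distributive_lattice prec)
    (Hweak : forall v w : multiperm alpha,
       weak_le (std v) (std w) -> prec v w)
    (Hbruhat : forall v w : multiperm alpha,
       prec v w -> bruhat_le (std v) (std w)) :
  exists2 U : tree, is_bst_on (Jcompl alpha) U &
    forall v w : multiperm alpha, prec v w <-> leU U v w.
Proof.
have [meet [join lat]] := distributive_lattice_ops Hdl.
have [s [us ms precE]] := res_prec_shapes Hpo Hweak Hbruhat lat 0 (leqnn (sumn alpha)).
have ps : perm_eq s (Jcompl alpha).
  apply: uniq_perm => //; first by rewrite filter_uniq ?iota_uniq.
  by move=> k; rewrite ms; case: (boolP (k \in _)) => // /cut_lt ->.
have sn : {in s, forall l, 0 < l < sumn alpha}.
  by move=> l; rewrite ms => /andP[].
exists (bst s) => [|v w]; first by exists s.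
have rid (x : multiperm alpha) : res x 0 (sumn alpha) = x.
  by apply: res_inside => i j /inv_lt/andP[].
have := precE v w; rewrite !rid => ->; split=> [h [i j]|h k a b ks hb i j hi hj hv].
  move/(mem_IU _ _ _ ps) => [k [a [b [ks hb h1 h2 h3]]]].
  apply/(mem_IU _ _ _ ps); exists k, a, b; split=> //.
  by apply: (h k a b ks hb) h3; lia.
(* The cell [(i, j)] of the shape at [k], counted from 0, is moved to its coordinates in [Pn]. *)
have : (a.+1 + i, k.+1 + j) \in IU (bst s) v.
  apply/(mem_IU _ _ _ ps); exists k, a, b; rewrite !addKn; split=> //; lia.
move/h/(mem_IU _ _ _ ps) => [l [c [d [ls hc h1 h2 h3]]]].
(* A pair belongs to one label only: of two labels, the one listed first would lie within the bounds
   of the subtree of the other. *)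
have Elk : l = k.
  have [_ _ _ hnb] := hb; have [_ _ _ hnc] := hc.
  case: (ltngtP (index l s) (index k s)) => hi'; last by apply: index_inj hi'.
    by have := hnb l; rewrite in_take // => /(_ hi'); lia.
  by have := hnc k; rewrite in_take // => /(_ hi'); lia.
subst l; move/(Rtree_max_bounds _ _ us sn ks): hb => E.
move/(Rtree_max_bounds _ _ us sn ks): hc; rewrite E => -[Ea Eb].
by move: h3; rewrite -Ea -Eb !addKn.
Qed.
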